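(* Let $\mathcal H$ be a complex separable Hilbert space and let $T$ be a bounded linear operator on $\mathcal H$ such that $T = \bigoplus_{j=1}^n T_j$ with respect to an orthogonal decomposition $\mathcal H = \bigoplus_{j=1}^n \mathcal H_j$, where $n$ is either a positive integer or $\infty$ (in which case the direct sum is countably infinite), and each $T_j$ is an irreducible bounded linear operator on $\mathcal H_j$. Then $T$ is circular if and only if $T$ is strongly circular.
   Context: Let $\mathbb T=\{\lambda\in\mathbb C:|\lambda|=1\}$. A bounded linear operator $T$ on a complex Hilbert space $\mathcal H$ is circular if for each $\lambda\in\mathbb T$ there exists a unitary operator $U_\lambda$ on $\mathcal H$ such that $U_\lambda T=\lambda T U_\lambda$. It is strongly circular if the unitaries $U_\lambda$ can be chosen so that $\lambda\mapsto U_\lambda$ is a strongly continuous unitary representation of the group $\mathbb T$ on $\mathcal H$ (that is, a group homomorphism into the unitary group that is continuous in the strong operator topology). A bounded operator is irreducible if its only closed reducing subspaces (closed subspaces invariant under both the operator and its adjoint) are $\{0\}$ and the whole space. *)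

(* Defs.v *)
From HB Require Import structures.
From mathcomp Require Import all_boot all_order all_algebra.
From mathcomp Require Import all_classical all_reals all_analysis.
From mathcomp Require Import complex.

Set Implicit Arguments.
Unset Strict Implicit.
Unset Printing Implicit Defensive.

Import Order.TTheory GRing.Theory Num.Theory.
Import numFieldNormedType.Exports.

Local Open Scope classical_set_scope.
Local Open Scope ring_scope.
Local Open Scope complex_scope.

(* Complex Hilbert spaces. As for every {dot _ for _}, the inner product is
   linear in its first argument and conjugate-linear in the second one. *)
HB.mixin Record CompleteNormedModule_isHilbert (R : realType) H
    & CompleteNormedModule R[i] H := {
  inner : {dot H for Num.conj};
  sqr_norm_inner : forall x : H, `|x| ^+ 2 = inner x x
}.

#[short(type="hilbertType")]
HB.structure Definition Hilbert (R : realType) :=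
  {H of CompleteNormedModule R[i] H & CompleteNormedModule_isHilbert R H}.

Definition separable (T : topologicalType) :=
  exists2 S : set T, countable S & dense S.

Section Operators.
Variables (R : realType) (H : hilbertType R).
Implicit Types (T U : {linear H -> H}) (M : set H).

Definition bounded_operator T :=
  exists C : R, forall x : H, `|T x| <= C%:C * `|x|.

(* For a bounded T the vector z selected here exists by the Riesz
   representation theorem, and is unique; the default value 0 is irrelevant. *)
Definition adjoint T (y : H) : H :=
  xget 0 [set z : H | forall x : H, inner (T x) y = inner x z].

Definition unitary U :=
  [/\ bounded_operator U,
      forall x : H, adjoint U (U x) = x &
      forall x : H, U (adjoint U x) = x].

Definition closed_subspace M :=
  [/\ closed M, M 0 &
      forall (a : R[i]) (x y : H), M x -> M y -> M (a *: x + y)].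

Definition reducing T M :=
  [/\ closed_subspace M,
      forall x : H, M x -> M (T x) &
      forall x : H, M x -> M (adjoint T x)].

Definition irreducible T :=
  forall M, reducing T M -> M = [set 0] \/ M = [set: H].

Definition circle : set R[i]^o := [set l | `|l| = 1].

Definition circular T :=
  forall l : R[i], circle l ->
    exists U : {linear H -> H},
      unitary U /\ forall x : H, U (T x) = l *: T (U x).

(* Only the restriction of U to the unit circle matters. *)
Definition unitary_representation (U : R[i] -> {linear H -> H}) :=
  [/\ forall l : R[i], circle l -> unitary (U l),
      forall l m : R[i], circle l -> circle m ->
        forall x : H, U (l * m) x = U l (U m x) &
      forall x : H, {within circle, continuous (fun l : R[i]^o => U l x)}].

Definition strongly_circular T :=
  exists U : R[i] -> {linear H -> H},
    unitary_representation U /\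
    forall l : R[i], circle l -> forall x : H, U l (T x) = l *: T (U l x).

End Operators.

(* The summands of H = (+)_j Hs j are given as Hilbert spaces together with
   isometric embeddings V j into H; the closed subspaces of the decomposition
   are the ranges of the V j. *)
Definition orthogonal_decomposition (R : realType) (H : hilbertType R)
    (J : Type) (Hs : J -> hilbertType R)
    (V : forall j, {linear Hs j -> H}) :=
  [/\ forall j (x y : Hs j), inner (V j x) (V j y) = inner x y,
      forall j k (x : Hs j) (y : Hs k), j <> k -> inner (V j x) (V k y) = 0 &
      dense [set z : H | exists (s : seq J) (x : forall j, Hs j),
                           z = \sum_(j <- s) V j (x j)]].

Definition direct_sum_operator (R : realType) (H : hilbertType R)
    (J : Type) (Hs : J -> hilbertType R) (V : forall j, {linear Hs j -> H})
    (T : {linear H -> H}) (Ts : forall j, {linear Hs j -> Hs j}) :=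
  orthogonal_decomposition V /\
  forall j (x : Hs j), T (V j x) = V j (Ts j x).

(* The index set {1, ..., n} of the summands, None standing for n = oo. *)
Definition summands (n : option nat) : Type :=
  if n is Some m then 'I_m else nat.

(* Main.v *)
Require Import Defs.
From HB Require Import structures.
From mathcomp Require Import all_boot all_order all_algebra.
From mathcomp Require Import all_classical all_reals all_analysis.
From mathcomp Require Import complex.
From mathcomp Require Import ring lra.

(* Let T be circular.  For a summand T_j and an angle t, some compression
   V_k^* U V_j of a unitary U with U T = e^(it) T U is a nonzero operator
   intertwining T_j and e^(it) T_k, together with their adjoints.  Fix a nonzero
   vector x.  For given k and z, the angles t for which such a contraction A maps
   x close to z form a closed set, by weak compactness; as k and z range over
   countable sets these sets cover R, so by Baire one of them has an interior.
   The operators B^* A, with A and B taken from this set, intertwine T_j and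
   e^(it) T_j for every small t, and <B^* A x, x> is bounded away from 0.

   By Schur's lemma the intertwiners of T_j and e^(it) T_j are then the multiples
   of a single unitary U_t, for every t.  When t = 2 pi / N, normalize
   U_t^N = 1: the lower bound on <U_t^l x, x> for small l t and Parseval's
   identity give an eigenvector of U_t whose inner product with x is bounded
   below independently of N.  Along N = M 2^n these eigenvectors have a nonzero
   weak limit e, which is an eigenvector of U_t for every t in a dense set, hence
   for every t.  Normalizing U_t e = e makes t |-> U_t a representation, which is
   continuous because any weak limit point of U_s as s tends to t is an
   intertwiner that fixes e. *)

Set Implicit Arguments.
Unset Strict Implicit.
Unset Printing Implicit Defensive.

Import Order.TTheory GRing.Theory Num.Theory.
Import numFieldNormedType.Exports.

Local Open Scope classical_set_scope.
Local Open Scope ring_scope.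
Local Open Scope complex_scope.

(** * Hilbert spaces as real inner product spaces *)

Local Notation iC := (Complex 0 1).

Lemma ReD (R : rcfType) (a b : R[i]) :
  complex.Re (a + b) = complex.Re a + complex.Re b.
Proof. by case: a => ? ?; case: b. Qed.

Lemma ReN (R : rcfType) (a : R[i]) : complex.Re (- a) = - complex.Re a.
Proof. by case: a. Qed.

Lemma ReM (R : rcfType) (a b : R[i]) :
  complex.Re (a * b) = complex.Re a * complex.Re b - complex.Im a * complex.Im b.
Proof. by case: a => ? ?; case: b. Qed.

Lemma ImM (R : rcfType) (a b : R[i]) :
  complex.Im (a * b) = complex.Re a * complex.Im b + complex.Im a * complex.Re b.
Proof. by case: a => ? ?; case: b. Qed.

Section RealInner.
Variables (R : realType) (H : hilbertType R).
Implicit Types (x y z : H) (a : R[i]).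

(** With real parts every estimate lives in the ordered field [R], within reach of [lra]; [innerE]
    recovers the complex inner product. *)
Definition rip x y : R := complex.Re (inner x y).
Definition n2 x : R := rip x x.

Lemma innerC x y : inner x y = conjc (inner y x).
Proof. by rewrite (hermC inner x y) expr0 mul1r. Qed.

Lemma innerZl a x y : inner (a *: x) y = a * inner x y.
Proof. exact: (linearZl_LR inner). Qed.

Lemma innerZr a x y : inner x (a *: y) = conjc a * inner x y.
Proof. exact: (linearZr_LR inner). Qed.

Lemma innerDl x y z : inner (x + y) z = inner x z + inner y z.
Proof. exact: (linearDl inner). Qed.

Lemma inner_suml (I : Type) (r : seq I) (F : I -> H) y :
  inner (\sum_(j <- r) F j) y = \sum_(j <- r) inner (F j) y.
Proof. exact: (linear_sumlz inner). Qed.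

Lemma inner_sumr (I : Type) (r : seq I) (F : I -> H) y :
  inner y (\sum_(j <- r) F j) = \sum_(j <- r) inner y (F j).
Proof. exact: (linear_sumr inner). Qed.

Lemma ripC x y : rip x y = rip y x.
Proof. by rewrite /rip innerC; case: (inner y x). Qed.

Lemma ripDl x y z : rip (x + y) z = rip x z + rip y z.
Proof. by rewrite /rip innerDl ReD. Qed.

Lemma ripDr x y z : rip x (y + z) = rip x y + rip x z.
Proof. by rewrite ripC ripDl !(ripC x). Qed.

Lemma ripNl x y : rip (- x) y = - rip x y.
Proof. by rewrite /rip (linearNl inner) ReN. Qed.

Lemma ripNr x y : rip x (- y) = - rip x y.
Proof. by rewrite ripC ripNl ripC. Qed.

Lemma ripBl x y z : rip (x - y) z = rip x z - rip y z.
Proof. by rewrite ripDl ripNl. Qed.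

Lemma ripBr x y z : rip x (y - z) = rip x y - rip x z.
Proof. by rewrite ripDr ripNr. Qed.

Lemma rip0l x : rip 0 x = 0.
Proof. by rewrite /rip (linear0l inner). Qed.

Lemma rip0r x : rip x 0 = 0.
Proof. by rewrite ripC rip0l. Qed.

Lemma ripZl (t : R) x y : rip (t%:C *: x) y = t * rip x y.
Proof. by rewrite /rip innerZl ReM /=; ring. Qed.

Lemma ripZr (t : R) x y : rip x (t%:C *: y) = t * rip x y.
Proof. by rewrite ripC ripZl ripC. Qed.

Lemma ripZlC a x y : rip (a *: x) y = rip x (conjc a *: y).
Proof. by rewrite /rip innerZl innerZr conjcK. Qed.

Lemma ripZrC a x y : rip x (a *: y) = rip (conjc a *: x) y.
Proof. by rewrite ripZlC conjcK. Qed.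

Lemma rip_iZr a x y :
  rip x (a *: y) = complex.Re a * rip x y + complex.Im a * rip x (iC *: y).
Proof.
by rewrite /rip !innerZr !ReM; case: a => u v /=; ring.
Qed.

Lemma innerE x y : inner x y = rip x y +i* rip x (iC *: y).
Proof.
by rewrite /rip innerZr ReM; case: (inner x y) => s t /=; congr Complex; ring.
Qed.

Lemma normE x : `|x| ^+ 2 = (n2 x)%:C.
Proof.
rewrite sqr_norm_inner /n2 /rip -sqr_norm_inner.
by rewrite RRe_real // rpredX // normr_real.
Qed.

Lemma inner_n2 x : inner x x = (n2 x)%:C.
Proof. by rewrite -normE sqr_norm_inner. Qed.

Lemma n2_ge0 x : 0 <= n2 x.
Proof. by rewrite -(ler0c (n2 x)) -normE exprn_ge0. Qed.

Lemma n2_eq0 x : n2 x = 0 -> x = 0.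
Proof.
by move=> n0; have := normE x; rewrite n0 => /eqP; rewrite expf_eq0 /= normr_eq0 => /eqP.
Qed.

Lemma n2_0 : n2 0 = 0.
Proof. exact: rip0l. Qed.

Lemma n2_gt0 x : x <> 0 -> 0 < n2 x.
Proof.
by move=> x0; rewrite lt_neqAle n2_ge0 andbT eq_sym; apply/eqP => /n2_eq0.
Qed.

Lemma n2D x y : n2 (x + y) = n2 x + n2 y + 2 * rip x y.
Proof. by rewrite /n2 !ripDl !ripDr (ripC y x); ring. Qed.

Lemma n2B x y : n2 (x - y) = n2 x + n2 y - 2 * rip x y.
Proof. by rewrite /n2 !ripBl !ripBr (ripC y x); ring. Qed.

Lemma n2N x : n2 (- x) = n2 x.
Proof. by rewrite /n2 ripNl ripNr opprK. Qed.

Lemma n2Z (t : R) x : n2 (t%:C *: x) = t ^+ 2 * n2 x.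
Proof. by rewrite /n2 ripZl ripZr; ring. Qed.

Lemma n2ZC a x : n2 (a *: x) = (complex.Re a ^+ 2 + complex.Im a ^+ 2) * n2 x.
Proof.
rewrite {1}/n2 /rip innerZl innerZr mulrA inner_n2 !ReM !ImM /=.
by case: a => u v /=; ring.
Qed.

Lemma rip_le x y : 2 * rip x y <= n2 x + n2 y.
Proof. by have := n2_ge0 (x - y); rewrite n2B; lra. Qed.

Lemma rip_CS x y : rip x y ^+ 2 <= n2 x * n2 y.
Proof.
have [->|/eqP y0] := eqVneq y 0; first by rewrite rip0r n2_0 expr0n mulr0.
have := n2_ge0 ((n2 y)%:C *: x - (rip x y)%:C *: y).
rewrite n2B !n2Z ripZl ripZr => h.
have p := n2_gt0 y0.
by rewrite -subr_ge0 -(pmulr_rge0 _ p) (le_trans h) // le_eqVlt; apply/orP; left; apply/eqP; ring.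
Qed.

Lemma rip_eq x y : (forall z, rip x z = rip y z) -> x = y.
Proof.
move=> e; apply/eqP; rewrite -subr_eq0; apply/eqP/n2_eq0.
by rewrite /n2 ripBl e subrr.
Qed.

Lemma rip_eqr x y : (forall z, rip z x = rip z y) -> x = y.
Proof. by move=> e; apply: rip_eq => z; rewrite ripC e ripC. Qed.

Lemma n2D_le x y : n2 (x + y) <= 2 * n2 x + 2 * n2 y.
Proof. by rewrite n2D; have := rip_le x y; lra. Qed.

Lemma norm_n2 x : `|x| = (Num.sqrt (n2 x))%:C.
Proof.
apply/eqP; rewrite -(@eqrXn2 _ 2) //; last by rewrite ler0c sqrtr_ge0.
by rewrite normE -rmorphXn /= sqr_sqrtr // n2_ge0.
Qed.

Lemma norm_ltP x (e : R) : 0 < e -> (`|x| < e%:C) = (n2 x < e ^+ 2).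
Proof.
by move=> e0; rewrite norm_n2 ltcR -[in RHS](sqr_sqrtr (n2_ge0 x)) ltr_pXn2r // nnegrE ?sqrtr_ge0 ?ltW.
Qed.

End RealInner.

(** * Norm topology through squared norms *)

Section Topo.
Variables (R : realType) (H : hilbertType R).
Implicit Types (x y z : H) (M : set H).

Lemma pos_complex (e : R[i]) : 0 < e -> exists2 r : R, 0 < r & e = r%:C.
Proof.
case: e => r s; rewrite ltcE /= => /andP[/eqP -> r0].
by exists r.
Qed.

Lemma cvg_n2P (I : Type) (F : set_system I) (FF : Filter F) (f : I -> H) y :
  f @ F --> y <-> forall e : R, 0 < e -> \forall i \near F, n2 (f i - y) < e.
Proof.
split.
  move=> /cvgrPdist_lt h e e0.
  have s0 : 0 < Num.sqrt e by rewrite sqrtr_gt0.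
  have /h : 0 < (Num.sqrt e)%:C by rewrite ltcR.
  apply: filterS => i; rewrite norm_ltP // sqr_sqrtr ?ltW // => l.
  by rewrite -n2N opprB.
move=> h; apply/cvgrPdist_lt => e /pos_complex[r r0 ->].
have /h : 0 < r ^+ 2 by rewrite exprn_gt0.
by apply: filterS => i l; rewrite norm_ltP // -n2N opprB.
Qed.

Lemma nbhs_n2P (A : set H) x :
  nbhs x A <-> exists2 e : R, 0 < e & forall y, n2 (y - x) < e -> A y.
Proof.
split.
  move=> /nbhs_ballP[e /= /pos_complex[r r0 ->] h].
  exists (r ^+ 2); first by rewrite exprn_gt0.
  move=> y yx; apply: h; rewrite -ball_normE /= norm_ltP //.
  by rewrite -n2N opprB.
move=> [e e0 h]; apply/nbhs_ballP; exists (Num.sqrt e)%:C; first by rewrite /= ltcR sqrtr_gt0.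
move=> y; rewrite -ball_normE /= norm_ltP ?sqrtr_gt0 // sqr_sqrtr ?ltW // => l.
by apply: h; rewrite -n2N opprB.
Qed.

Lemma closed_n2 M :
  (forall x, (forall e : R, 0 < e -> exists2 y, M y & n2 (y - x) < e) -> M x) ->
  closed M.
Proof.
move=> h x Mx; apply: h => e e0.
have : nbhs x [set y | n2 (y - x) < e] by apply/nbhs_n2P; exists e.
by move=> /Mx [y [My ?]]; exists y.
Qed.

Lemma dense_n2 M : dense M <-> forall x (e : R), 0 < e -> exists2 y, M y & n2 (y - x) < e.
Proof.
split.
  move=> dM x e e0.
  have nx : nbhs x [set y | n2 (y - x) < e] by apply/nbhs_n2P; exists e.
  have [||y [yO My]] := dM (interior [set y | n2 (y - x) < e]).
  - by exists x.
  - exact: open_interior.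
  by exists y => //; exact: interior_subset yO.
move=> h O [x Ox] oO.
have /nbhs_n2P[e e0 he] : nbhs x O by exact: open_nbhs_nbhs.
by have [y My /he Oy] := h x e e0; exists y.
Qed.

Lemma cauchy_n2 (u : nat -> H) :
  (forall e : R, 0 < e -> exists N, forall m n, (N <= m)%N -> (N <= n)%N -> n2 (u m - u n) < e) ->
  exists y, forall e : R, 0 < e -> \forall n \near \oo, n2 (u n - y) < e.
Proof.
move=> h.
have : cauchy (u @ \oo).
  apply/cauchy_ballP => e /pos_complex[r r0 ->].
  have [N hN] := h (r ^+ 2) (exprn_gt0 2 r0).
  exists (u @` [set n | (N <= n)%N], u @` [set n | (N <= n)%N]) => /=.
    by split; exists N => // n /= Nn; exists n.
  move=> [_ _] /= [[m Nm <-] [n Nn <-]].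
  by rewrite -ball_normE /= norm_ltP //; exact: hN.
move=> /cauchy_cvg /cvg_ex [y yl]; exists y; exact/cvg_n2P.
Qed.

End Topo.

Section LinearMaps.
Variables (R : realType) (H1 H2 : hilbertType R) (A : {linear H1 -> H2}).

Lemma opD x y : A (x + y) = A x + A y. Proof. exact: linearD. Qed.
Lemma opB x y : A (x - y) = A x - A y. Proof. exact: linearB. Qed.
Lemma opZ a x : A (a *: x) = a *: A x. Proof. exact: linearZZ. Qed.
Lemma op0 : A 0 = 0. Proof. exact: linear0. Qed.

End LinearMaps.

(** * The Riesz representation theorem and weak limits along ultrafilters *)

(** The choice t = - g / (a + 1) gives the value - (g / (a + 1))^2; adding 1 keeps the denominator
    nonzero when a = 0. This is the first-order condition at a minimum. *)
Lemma quadratic_ge0_lin0 (R : realType) (a g : R) :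
  0 <= a -> (forall t, 0 <= t ^+ 2 * a + t * g) -> g = 0.
Proof.
move=> a0 /(_ (- g / (a + 1))) h.
have a1 : a + 1 != 0 by lra.
have e : (- g / (a + 1)) ^+ 2 * a + (- g / (a + 1)) * g = - (g / (a + 1)) ^+ 2.
  by field.
move: h; rewrite e oppr_ge0 => h.
have := sqr_ge0 (g / (a + 1)) => h'.
have /eqP : (g / (a + 1)) ^+ 2 = 0 by apply/le_anti; rewrite h h'.
by rewrite expf_eq0 /= mulf_eq0 invr_eq0 (negbTE a1) orbF => /eqP.
Qed.

Definition natinv (R : realType) (n : nat) : R := n.+1%:R^-1.

Lemma natinv_gt0 (R : realType) n : 0 < natinv R n.
Proof. by rewrite invr_gt0. Qed.

Lemma natinv_small (R : realType) (e : R) : 0 < e ->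
  exists N, forall n, (N <= n)%N -> natinv R n < e.
Proof.
move=> e0; have [N _ hN] := near_infty_natSinv_lt (PosNum e0).
by exists N => n Nn; exact: hN.
Qed.

Section LaxMilgram.
Variables (R : realType) (H : hilbertType R).
Implicit Types (x y z : H).

(* Minimize [n2 z + n2 (S z) - 2 * f z]; the parallelogram identity makes
   minimizing sequences Cauchy. *)
Lemma lax_milgram (S : {linear H -> H}) (f : H -> R) (C K : R) :
  (forall x y, f (x + y) = f x + f y) ->
  (forall (t : R) x, f (t%:C *: x) = t * f x) ->
  (forall x, f x <= n2 x + C) -> (forall x, n2 (S x) <= K * n2 x) ->
  exists y, forall z, f z = rip z y + rip (S z) (S y).
Proof.
move=> fD fZ fC SK.
pose N z := n2 z + n2 (S z).
pose J z := N z - 2 * f z.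
have N0 z : 0 <= N z by rewrite addr_ge0 // n2_ge0.
(* The bound on [f] at z / 2 gives 2 f z = 4 f (z / 2) <= n2 z + 4 C. *)
have Jlb z : - (4 * C) <= J z.
  have := fC ((2^-1)%:C *: z); rewrite fZ n2Z /J /N => h.
  have := n2_ge0 (S z); have -> : 2 * f z = 4 * (2^-1 * f z) by field.
  move: h; have -> : 2^-1 ^+ 2 * n2 z = n2 z / 4 by field.
  lra.
pose A := [set J z | z in [set: H]].
have hA : has_inf A.
  split; first by exists (J 0), 0.
  by exists (- (4 * C)) => _ [z _ <-].
pose m := inf A.
have mJ z : m <= J z by apply: ge_inf; [exact: hA.2 | exists z].
have [u hu] : {u : nat -> H & forall n, J (u n) < m + natinv R n}.
  apply: (choice (P := fun n z => J z < m + natinv R n)) => n.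
  have [|_ [z _ <-] h] := @inf_adherent _ A (natinv R n) _ hA.
    exact: natinv_gt0.
  by exists z.
have Jpar z w : N (z - w) = 2 * J z + 2 * J w - 4 * J ((2^-1)%:C *: (z + w)).
  rewrite /J /N fZ fD (opZ S) (opB S) (opD S) !n2Z !n2B !n2D; by field.
have [y hy] : exists y, forall e : R, 0 < e -> \forall n \near \oo, n2 (u n - y) < e.
  apply: cauchy_n2 => e e0.
  have e4 : 0 < e / 4 by lra.
  have [n0 hn0] := natinv_small e4.
  exists n0 => p q /hn0 hp /hn0 hq.
  have : n2 (u p - u q) <= N (u p - u q) by rewrite lerDl n2_ge0.
  rewrite Jpar; have := hu p; have := hu q; have := mJ ((2^-1)%:C *: (u p + u q)).
  lra.
exists y => w.
apply/eqP; rewrite eq_sym -subr_eq0; apply/eqP.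
set g := _ - _.
apply: (@quadratic_ge0_lin0 _ (N w)) => // t.
(* [J] is compared at u n and u n + t w, never at the limit. Bounding the cross terms with u n - y
   by [rip_le] costs a second t^2 N w, hence the factor 2. *)
suff : forall e : R, 0 < e -> - e <= (2 * t ^+ 2 * N w + 2 * t * g).
  move=> h; have : 0 <= 2 * t ^+ 2 * N w + 2 * t * g.
    by rewrite leNgt; apply/negP => l; have := h (- (2 * t ^+ 2 * N w + 2 * t * g) / 2); lra.
  nra.
move=> e e0.
have K0 : 0 < `|K| + 1 by rewrite ltr_wpDl.
have e1 : 0 < e / (2 * (1 + (`|K| + 1))) by apply: divr_gt0 => //; lra.
have [n1 _ h1] := hy _ e1.
have e2 : 0 < e / 2 by lra.
have [n2' h2] := natinv_small e2.
pose n := maxn n1 n2'.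
have {h1} h1 : n2 (u n - y) < e / (2 * (1 + (`|K| + 1))) by apply: h1; rewrite /= leq_maxl.
have {h2} h2 : natinv R n < e / 2 by apply: h2; rewrite leq_maxr.
have h3 := mJ (u n + t%:C *: w).
have h4 := hu n.
have E : J (u n + t%:C *: w) = J (u n) + t ^+ 2 * N w +
   2 * t * (rip w y + rip (S w) (S y) - f w)
   + 2 * rip (u n - y) (t%:C *: w) + 2 * rip (S (u n - y)) (S (t%:C *: w)).
  rewrite /J /N fD fZ (opD S) (opB S) (opZ S) !n2D !n2Z !ripZr !ripBl.
  by rewrite (ripC w) (ripC (S w)); ring.
rewrite E in h3.
have h5 := rip_le (u n - y) (t%:C *: w).
have h6 := rip_le (S (u n - y)) (S (t%:C *: w)).
rewrite (opZ S) in h3; rewrite !n2Z in h5; rewrite (opZ S) !n2Z in h6.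
have h7 : n2 (S (u n - y)) <= (`|K| + 1) * n2 (u n - y).
  apply: (le_trans (SK _)); apply: ler_wpM2r; first exact: n2_ge0.
  by rewrite (le_trans (ler_norm K)) // lerDl.
have h8 : (1 + (`|K| + 1)) * n2 (u n - y) < e / 2.
  move: h1; rewrite ltr_pdivlMr; last lra.
  lra.
by rewrite /N -/g in h3 *; lra.
Qed.

(** The case S = 0 of [lax_milgram]. The last hypothesis encodes boundedness: applied to all real
    multiples of x it yields |f x| <= 2 sqrt C |x|. *)
Lemma riesz (f : H -> R) (C : R) :
  (forall x y, f (x + y) = f x + f y) ->
  (forall (t : R) x, f (t%:C *: x) = t * f x) ->
  (forall x, f x <= n2 x + C) ->
  exists y, forall z, f z = rip z y.
Proof.
move=> fD fZ fC.
have [|y hy] := @lax_milgram (GRing.null_fun H) f C 0 fD fZ fC.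
  by move=> x; rewrite n2_0 mul0r.
by exists y => z; rewrite hy /= rip0l addr0.
Qed.

End LaxMilgram.

Section Ultra.
Variables (R : realType).

Lemma rlim_eq (I : Type) (F : set_system I) (FF : ProperFilter F)
    (f g : I -> R) (a b : R) :
  f i @[i --> F] --> a -> g i @[i --> F] --> b ->
  (\forall i \near F, f i = g i) -> a = b.
Proof.
move=> fa gb fg; have ga : g i @[i --> F] --> a.
  by apply: cvg_trans fa; apply: near_eq_cvg; apply: filterS fg => i ->.
exact: (cvg_unique _ ga gb).
Qed.

Lemma ultra_bounded_cvg (I : Type) (F : set_system I) (FU : UltraFilter F)
    (f : I -> R) (C : R) :
  (\forall i \near F, `|f i| <= C) -> exists l : R, f i @[i --> F] --> l.
Proof.
move=> h.
have : (f @ F) `[- C, C]%classic.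
  by apply: filterS h => i /=; rewrite in_itv /= ler_norml.
move=> hF.
have [l [_ hl]] := @segment_compact R (- C) C (f @ F) _ hF.
(* A cluster point of an ultrafilter is a limit: otherwise the ultrafilter would contain the
   preimage of the complement of a neighbourhood. *)
exists l => U Ul; have [//|] := @in_ultra_setVsetC _ F (f @^-1` U) FU.
by move=> FnU; have [y []] := hl (~` U) U FnU Ul.
Qed.

(** Weak compactness of balls: the limits of rip (u i) z form a bounded linear functional of z,
    represented by [riesz]. Its bound (C + n2 z) / 2, taken at z = y, gives n2 y <= C. *)
Lemma ultra_weak_cvg (H : hilbertType R) (I : Type) (F : set_system I)
    (FU : UltraFilter F) (u : I -> H) (C : R) :
  (\forall i \near F, n2 (u i) <= C) ->
  exists y, n2 y <= C /\ forall z, rip (u i) z @[i --> F] --> rip y z.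
Proof.
move=> uC.
have C0 : 0 <= C.
  have [k] := filter_ex uC; apply: le_trans; exact: n2_ge0.
have hb z : \forall i \near F, 2 * `|rip (u i) z| <= C + n2 z.
  near=> i.
  have h : n2 (u i) <= C by near: i.
  have := rip_le (u i) z; have := rip_le (u i) (- z); rewrite ripNr n2N.
  by case: (ger0P (rip (u i) z)) => _; lra.
have hc z : exists l : R, rip (u i) z @[i --> F] --> l.
  apply: (@ultra_bounded_cvg _ _ _ _ (C + n2 z)).
  by apply: filterS (hb z) => i; have := normr_ge0 (rip (u i) z); lra.
have [f hf] := choice hc.
have fle z : f z <= (C + n2 z) / 2.
  apply: (cvgr_to_le (hf z)).
  by apply: filterS (hb z) => i; have := ler_norm (rip (u i) z); lra.
have [|||y hy] := @riesz _ H f C.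
- move=> x y; apply: (@rlim_eq I F _ (fun i => rip (u i) (x + y)) (fun i => rip (u i) x + rip (u i) y) _ _ (hf _) (cvgD (hf x) (hf y))).
  by apply: nearW => i; rewrite ripDr.
- move=> t x; apply: (@rlim_eq I F _ (fun i => rip (u i) (t%:C *: x)) (fun i => t * rip (u i) x) _ _ (hf _) (cvgM (cvg_cst t) (hf x))).
  by apply: nearW => i; rewrite ripZr.
- by move=> x; have := fle x; have := n2_ge0 x; lra.
exists y; split; last by move=> z; rewrite ripC -hy.
by have := fle y; rewrite hy -/(n2 y); lra.
Unshelve. all: by end_near. Qed.

End Ultra.

(** * Adjoints and intertwiners *)

(** A relation, unlike [adjoint], also covers maps between different spaces. Real parts suffice for
    linear maps, by [adjp_inner]. *)
Definition adjp (R : realType) (H1 H2 : hilbertType R)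
    (A : H1 -> H2) (B : H2 -> H1) :=
  forall x y, rip (A x) y = rip x (B y).

Definition bnd (R : realType) (H1 H2 : hilbertType R) (A : H1 -> H2) (K : R) :=
  forall x, n2 (A x) <= K * n2 x.

Definition contr (R : realType) (H1 H2 : hilbertType R) (A : H1 -> H2) :=
  forall x, n2 (A x) <= n2 x.

Lemma linear_pack (R : realType) (H1 H2 : hilbertType R) (f : H1 -> H2) :
  (forall a x y, f (a *: x + y) = a *: f x + f y) ->
  exists g : {linear H1 -> H2}, forall x, g x = f x.
Proof.
move=> fL; pose L := GRing.isLinear.Build R[i] H1 H2 *:%R f fL.
by exists (HB.pack_for {linear H1 -> H2} f L).
Qed.

Section Adjoint.
Variables (R : realType).
Implicit Types (H : hilbertType R).

Lemma adjpC (H1 H2 : hilbertType R) (A : H1 -> H2) (B : H2 -> H1) :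
  adjp A B -> adjp B A.
Proof. by move=> h x y; rewrite ripC -h ripC. Qed.

Lemma adjp_comp (H1 H2 H3 : hilbertType R) (A : H1 -> H2) (A' : H2 -> H1)
    (B : H2 -> H3) (B' : H3 -> H2) :
  adjp A A' -> adjp B B' -> adjp (B \o A) (A' \o B').
Proof. by move=> hA hB x y /=; rewrite hB hA. Qed.

Lemma adjp_bnd (H1 H2 : hilbertType R) (A : H1 -> H2) (B : H2 -> H1) K :
  0 <= K -> adjp A B -> bnd A K -> bnd B K.
Proof.
move=> K0 AB AK y.
have [->|/eqP By0] := eqVneq (B y) 0; first by rewrite n2_0 mulr_ge0 // n2_ge0.
have p := n2_gt0 By0.
have h := rip_CS (A (B y)) y; rewrite AB -/(n2 (B y)) in h.
rewrite -(ler_pM2l p) -expr2 (le_trans h) // mulrCA mulrA.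
by apply: ler_wpM2r; [exact: n2_ge0 | exact: AK].
Qed.

Lemma adjp_contr (H1 H2 : hilbertType R) (A : H1 -> H2) (B : H2 -> H1) :
  adjp A B -> contr A -> contr B.
Proof.
move=> AB cA x; rewrite -[leRHS]mul1r.
by apply: (adjp_bnd ler01 AB) => y; rewrite mul1r.
Qed.

Lemma adjp_ex (H1 H2 : hilbertType R) (A : {linear H1 -> H2}) K :
  bnd A K -> exists B : {linear H2 -> H1}, adjp A B.
Proof.
move=> AK.
have h y : exists z, forall x, rip (A x) y = rip x z.
  (* Weighting A x by 1 / s and y by s turns [rip_le] into the bound n2 x + C of [riesz], since s^2
     >= s >= K. *)
  pose s := `|K| + 1.
  have s1 : 1 <= s by rewrite lerDr.
  have s0 : s != 0 by rewrite gt_eqF // (lt_le_trans _ s1).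
  apply: (@riesz _ H1 (fun x => rip (A x) y) (s ^+ 2 * n2 y)).
  - by move=> x x'; rewrite opD ripDl.
  - by move=> t x; rewrite opZ ripZl.
  - move=> x; have := rip_le ((s^-1)%:C *: A x) (s%:C *: y).
    rewrite ripZl ripZr (mulrA s^-1) mulVf // mul1r !n2Z => h.
    have h1 : s^-1 ^+ 2 * n2 (A x) <= n2 x.
      rewrite exprVn ler_pdivrMl; last by rewrite exprn_gt0 // (lt_le_trans _ s1).
      apply: (le_trans (AK x)); apply: ler_wpM2r; first exact: n2_ge0.
      by apply: (@le_trans _ _ s); [rewrite ler_wpDr // ler_norm | rewrite ler_eXnr].
    have := n2_ge0 x; have := mulr_ge0 (sqr_ge0 s) (n2_ge0 y); lra.
have [B hB] := choice h.
have [|B' hB'] := @linear_pack _ H2 H1 B.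
  move=> a x y; apply: rip_eqr => z.
  by rewrite -hB !ripDr (ripZrC a (A z)) (ripZrC a z) -opZ !hB.
by exists B' => x y; rewrite hB' hB.
Qed.

Lemma adjp_inner (H1 H2 : hilbertType R) (A : H1 -> H2) (B : {linear H2 -> H1}) :
  adjp A B -> forall x y, inner (A x) y = inner x (B y).
Proof. by move=> AB x y; rewrite !innerE AB -opZ AB. Qed.

Lemma adjp_adjoint H (T T' : {linear H -> H}) :
  adjp T T' -> forall y, adjoint T y = T' y.
Proof.
move=> TT' y; rewrite /adjoint; case: xgetP => [z -> /= hz|/(_ (T' y))].
  by apply: rip_eqr => x; rewrite /rip -hz (adjp_inner TT').
by case=> x; rewrite (adjp_inner TT').
Qed.

Lemma bounded_bnd H (T : {linear H -> H}) :
  bounded_operator T -> exists2 K, 0 <= K & bnd T K.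
Proof.
move=> [C hC]; exists (C ^+ 2); first exact: sqr_ge0.
move=> x; rewrite -lecR rmorphM rmorphXn /= -!normE -exprMn.
by rewrite ler_pXn2r ?nnegrE ?hC // (le_trans _ (hC x)).
Qed.

Lemma contr_bounded H (T : {linear H -> H}) : contr T -> bounded_operator T.
Proof.
move=> cT; exists 1 => x; rewrite mul1r !norm_n2 lecR.
exact: ler_wsqrtr.
Qed.

End Adjoint.

Section Weak.
Variables (R : realType).

Definition wlim (H : hilbertType R) (I : Type) (F : set_system I)
    (u : I -> H) (y : H) :=
  forall z, rip (u i) z @[i --> F] --> rip y z.

Section Limits.
Variables (I : Type) (F : set_system I) (FF : ProperFilter F).

Lemma wlim_cst (H : hilbertType R) (y : H) : wlim F (fun=> y) y.
Proof. by move=> z; exact: cvg_cst. Qed.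

Lemma wlim_unique (H : hilbertType R) (u v : I -> H) y z :
  wlim F u y -> wlim F v z -> (\forall i \near F, u i = v i) -> y = z.
Proof.
move=> uy vz uv; apply: rip_eq => w; apply: (@rlim_eq _ I F _ (fun i => rip (u i) w) (fun i => rip (v i) w) _ _ (uy w) (vz w)).
by apply: filterS uv => i ->.
Qed.

Lemma wlim_adj (H1 H2 : hilbertType R) (A : H1 -> H2) (B : H2 -> H1)
    (u : I -> H1) y :
  adjp A B -> wlim F u y -> wlim F (A \o u) (A y).
Proof.
move=> AB uy z; rewrite AB; under eq_fun do rewrite /= AB.
exact: uy.
Qed.

Lemma wlimD (H : hilbertType R) (u v : I -> H) y z :
  wlim F u y -> wlim F v z -> wlim F (fun i => u i + v i) (y + z).
Proof.
move=> uy vz w; rewrite ripDl; under eq_fun do rewrite ripDl.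
exact: cvgD.
Qed.

Lemma wlimZ (H : hilbertType R) (u : I -> H) y (l : I -> R[i]) (l0 : R[i]) :
  complex.Re (l i) @[i --> F] --> complex.Re l0 ->
  complex.Im (l i) @[i --> F] --> complex.Im l0 ->
  wlim F u y -> wlim F (fun i => l i *: u i) (l0 *: y).
Proof.
have E (a : R[i]) (x z : H) :
  rip (a *: x) z = complex.Re a * rip x z - complex.Im a * rip x (Complex 0 1 *: z).
  by rewrite ripZlC rip_iZr; case: a => s t /=; rewrite mulNr.
move=> hr hi uy z; rewrite E; under eq_fun do rewrite E.
by apply: cvgB; apply: cvgM.
Qed.

(** Weak lower semicontinuity of the norm: pair with y, apply [rip_le], and solve for n2 y in the
    limit. *)
Lemma wlim_n2 (H : hilbertType R) (u : I -> H) y C :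
  (\forall i \near F, n2 (u i) <= C) -> wlim F u y -> n2 y <= C.
Proof.
move=> uC uy.
have : rip y y <= (C + n2 y) / 2.
  apply: (cvgr_to_le (uy y)); apply: filterS uC => i h.
  by have := rip_le (u i) y; lra.
by rewrite -/(n2 y); lra.
Qed.

End Limits.

(** Compactness of the unit ball of operators in the weak operator topology, pointwise from
    [ultra_weak_cvg]; linearity passes to the limit. *)
Lemma ultra_wlim_op (H1 H2 : hilbertType R) (I : Type) (F : set_system I)
    (FU : UltraFilter F) (A : I -> H1 -> H2) :
  (\forall i \near F, linear (A i) /\ contr (A i)) ->
  exists B : {linear H1 -> H2}, contr B /\ forall x, wlim F (A^~ x) (B x).
Proof.
move=> hA.
have h x : exists y, n2 y <= n2 x /\ wlim F (A^~ x) y.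
  by apply: ultra_weak_cvg; apply: filterS hA => i [_]; apply.
have [B hB] := choice h.
have [|B' hB'] := @linear_pack _ H1 H2 B.
  move=> a x y.
  apply: (@wlim_unique _ F _ H2 (A^~ (a *: x + y)) (fun i => a *: A i x + A i y)).
  - exact: (hB _).2.
  - by apply: wlimD (hB y).2; apply: wlimZ (hB x).2; exact: cvg_cst.
  by apply: filterS hA => i [Li _]; rewrite Li.
exists B'; split => x; first by rewrite hB' (hB x).1.
by rewrite hB'; exact: (hB x).2.
Qed.

End Weak.

Section Inter.
Variables (R : realType) (H1 H2 : hilbertType R).
Variables (T1 T1' : {linear H1 -> H1}) (T2 T2' : {linear H2 -> H2}).

(* [T1'] and [T2'] stand for the adjoints of [T1] and [T2]. *)
Definition inter (l : R[i]) (A : H1 -> H2) :=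
  [/\ contr A, forall x, A (T1 x) = l *: T2 (A x) &
      forall x, A (T1' x) = conjc l *: T2' (A x)].

(** Operators with an adjoint are weakly continuous, so both sides of each intertwining relation
    converge weakly. *)
Lemma inter_wlim (I : Type) (F : set_system I) (FF : ProperFilter F)
    (A : I -> H1 -> H2) (B : H1 -> H2) (l : I -> R[i]) (l0 : R[i]) :
  adjp T2 T2' ->
  complex.Re (l i) @[i --> F] --> complex.Re l0 ->
  complex.Im (l i) @[i --> F] --> complex.Im l0 ->
  (\forall i \near F, inter (l i) (A i)) ->
  contr B -> (forall x, wlim F (A^~ x) (B x)) ->
  inter l0 B.
Proof.
move=> a2 hr hi hA cB hB; split => // x.
- apply: (@wlim_unique _ _ _ _ _ _ (fun i => l i *: T2 (A i x)) _ _ (hB (T1 x))).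
    exact: wlimZ hr hi (wlim_adj a2 (hB x)).
  by apply: filterS hA => i [_ h _].
- apply: (@wlim_unique _ _ _ _ _ _ (fun i => conjc (l i) *: T2' (A i x)) _ _ (hB (T1' x))).
    apply: wlimZ; last exact: wlim_adj (adjpC a2) (hB x).
    + have E (a : R[i]) : complex.Re (conjc a) = complex.Re a by case: a.
      by rewrite E; under eq_fun do rewrite E.
    + have E (a : R[i]) : complex.Im (conjc a) = - complex.Im a by case: a.
      by rewrite E; under eq_fun do rewrite E; exact: cvgN.
  by apply: filterS hA => i [_ _ h].
Qed.

End Inter.

(** * Schur's lemma *)

Lemma conj_iC (R : rcfType) : conjc (iC : R[i]) = - iC.
Proof. by congr Complex; rewrite oppr0. Qed.

Lemma mul_iC (R : rcfType) : iC * iC = -1 :> R[i].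
Proof. by rewrite -expr2 sqr_i. Qed.

Section ConvexSequences.
Variables (R : realType) (a : nat -> R).
Hypothesis a_convex : forall n, 2 * a n.+1 <= a n + a n.+2.

(** Increments of a convex sequence grow, so one positive increment would force linear growth. *)
Lemma convex_bounded_le C : (forall n, a n <= C) -> forall n, a n.+1 <= a n.
Proof.
move=> aC n; rewrite leNgt; apply/negP => lt_n.
pose d := a n.+1 - a n.
have d0 : 0 < d by rewrite subr_gt0.
have incr k : d <= a (n + k).+1 - a (n + k)%N.
  elim: k => [|k IH]; first by rewrite addn0.
  by rewrite addnS; have := a_convex (n + k); lra.
have lin k : a n + k%:R * d <= a (n + k)%N.
  elim: k => [|k IH]; first by rewrite addn0 mul0r addr0.
  by rewrite addnS -natr1; have := incr k; lra.
have [k hk] : exists k : nat, (C - a n) / d < k%:R.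
  exists (Num.bound `|(C - a n) / d|).
  exact: le_lt_trans (ler_norm _) (archi_boundP (normr_ge0 _)).
have := lin k; have := aC (n + k)%N; move: hk; rewrite ltr_pdivrMr //; lra.
Qed.

(** By convexity, a decrease at step k forces a decrease at every earlier step. *)
Lemma convex_drop k : a k.+1 < a k -> a k <= a 0.
Proof.
elim: k => [//|k IH] lt_k.
have := a_convex k => h.
have lt_k' : a k.+1 < a k by lra.
by have := IH lt_k'; lra.
Qed.

Lemma convex_le_ends k n : (k <= n)%N -> a k <= a 0 \/ a k <= a n.
Proof.
elim: n => [|n IH]; first by rewrite leqn0 => /eqP ->; left.
rewrite leq_eqVlt ltnS => /orP[/eqP ->|/IH [|h]]; [by right|by left|].
have [|/convex_drop] := lerP (a n) (a n.+1); first by right; lra.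
by left; lra.
Qed.

End ConvexSequences.

Section StrongWeak.
Variables (R : realType) (H : hilbertType R).

Lemma strong_wlim (I : Type) (F : set_system I) (FF : ProperFilter F)
    (u : I -> H) y :
  (forall e : R, 0 < e -> \forall i \near F, n2 (u i - y) < e) -> wlim F u y.
Proof.
move=> uy z; apply/cvgrPdist_lt => e e0.
have p : 0 < n2 z + 1 by rewrite ltr_wpDl // n2_ge0.
have e1 : 0 < e ^+ 2 / (n2 z + 1) by rewrite divr_gt0 // exprn_gt0.
apply: filterS (uy _ e1) => i; rewrite ltr_pdivlMr // => h.
rewrite distrC -ripBl -ltr_sqr ?nnegrE ?(ltW e0) // real_normK ?num_real //.
apply: le_lt_trans (rip_CS _ _) _.
by apply: le_lt_trans h; have := n2_ge0 (u i - y); lra.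
Qed.

End StrongWeak.

Definition irr (R : realType) (H : hilbertType R) (T T' : H -> H) :=
  forall M : set H, closed_subspace M -> (forall x, M x -> M (T x)) ->
    (forall x, M x -> M (T' x)) -> M = [set 0] \/ M = [set: H].

Section Dichotomy.
Variables (R : realType) (H : hilbertType R) (T T' : {linear H -> H}).
Variables (KT KT' : R).
Hypotheses (T_bnd : bnd T KT) (T'_bnd : bnd T' KT') (T_irr : irr T T').

Section SelfAdjoint.
Variables (q : {linear H -> H}) (K : R).
Hypotheses (q_bnd : bnd q K) (K0 : 0 <= K) (q_adj : adjp q q).
Hypotheses (qT : forall x, q (T x) = T (q x)).
Hypotheses (qT' : forall x, q (T' x) = T' (q x)).

Let Q n : H -> H := iter n q.

Let Q_adj n : adjp (Q n) (Q n).
Proof.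
elim: n => [|n IH] x y //.
by rewrite [Q n.+1 y]iterSr -IH -q_adj.
Qed.

(** Self-adjointness gives n2 (q^(n+1) x) = rip (q^n x) (q^(n+2) x). *)
Let Q_convex x n : 2 * n2 (Q n.+1 x) <= n2 (Q n x) + n2 (Q n.+2 x).
Proof. by rewrite {1}/n2 [X in rip X _]iterS q_adj; exact: rip_le. Qed.

Let Q_lin n : exists g : {linear H -> H}, forall x, g x = Q n x.
Proof.
apply: linear_pack => a x y; elim: n => [//|n IH].
by rewrite -[LHS]/(q (Q n _)) IH opD opZ.
Qed.

Let Q_bnd n x : n2 (Q n x) <= K ^+ n * n2 x.
Proof.
elim: n => [|n IH]; first by rewrite mul1r.
rewrite exprS -mulrA; apply: (le_trans (q_bnd _)).
exact: ler_wpM2l.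
Qed.

Let Q_comm (S : H -> H) n x : (forall x, q (S x) = S (q x)) -> Q n (S x) = S (Q n x).
Proof. by move=> qS; elim: n => [//|n IH]; rewrite -[LHS]/(q (Q n _)) IH qS. Qed.

(* [M] is the spectral subspace of [q] for the interval [-1, 1]; convexity of
   [n |-> n2 (q^n x)] makes the orbits of its vectors nonincreasing. *)
Let M := [set x : H | exists C, forall n, n2 (Q n x) <= C].

Let M_reducing : closed_subspace M.
Proof.
split.
- apply: closed_n2 => x hx.
  have [u hu] : {u : nat -> H & forall n, M (u n) /\ n2 (u n - x) < natinv R n}.
    apply: (choice (P := fun n y => M y /\ n2 (y - x) < natinv R n)) => n.
    by have [y My yx] := hx _ (natinv_gt0 R n); exists y.
  have ux : wlim \oo u x.
    apply: strong_wlim => e /natinv_small[N hN]; exists N => // n /= /hN.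
    exact: lt_trans (hu n).2.
  (* Orbits in [M] are nonincreasing, so n2 (u k) bounds the orbit of u k, and n2 (u k) <= 2 n2 (u k
     - x) + 2 n2 x with n2 (u k - x) < 1 / (k + 1) <= 1. *)
  exists (2 * n2 x + 2) => n.
  apply: (@wlim_n2 _ nat \oo _ _ _ _ _ _ (wlim_adj (Q_adj n) ux)).
  apply: nearW => k /=.
  have [[C hC] kx] := hu k.
  have dec := convex_bounded_le (Q_convex (u k)) hC.
  have : n2 (Q n (u k)) <= n2 (u k).
    by elim: n => [//|n IH]; exact: le_trans (dec n) IH.
  have : n2 (u k) <= 2 * n2 (u k - x) + 2 * n2 x.
    by rewrite -[X in n2 X <= _](subrK x); exact: n2D_le.
  have : natinv R k <= 1 by rewrite invf_le1 // ler1n.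
  lra.
- exists 0 => n; have [g hg] := Q_lin n.
  by rewrite -hg op0 n2_0.
- move=> a x y [C hC] [D hD].
  exists (2 * ((complex.Re a ^+ 2 + complex.Im a ^+ 2) * C) + 2 * D) => n.
  have [g hg] := Q_lin n; rewrite -hg opD opZ !hg.
  apply: le_trans (n2D_le _ _) _; rewrite n2ZC.
  have := hD n; have : (complex.Re a ^+ 2 + complex.Im a ^+ 2) * n2 (Q n x) <=
    (complex.Re a ^+ 2 + complex.Im a ^+ 2) * C.
    by apply: ler_wpM2l; rewrite ?addr_ge0 ?sqr_ge0.
  lra.
Qed.

Let M_stable (S : H -> H) KS : bnd S KS -> (forall x, q (S x) = S (q x)) ->
  forall x, M x -> M (S x).
Proof.
move=> SK qS x [C hC]; exists (`|KS| * C) => n; rewrite Q_comm //.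
apply: (le_trans (SK _)); apply: (@le_trans _ _ (`|KS| * n2 (Q n x))).
  by apply: ler_wpM2r; [exact: n2_ge0|exact: ler_norm].
by apply: ler_wpM2l.
Qed.

(* [y n := (1 + q^(2n))^-1 x]: every weak limit point of [y] has bounded
   [q]-orbit, hence lies in [M]. *)
Let expanding : M = [set 0] -> forall x, n2 x <= n2 (q x).
Proof.
move=> M0 x.
have [y hy] : {y : nat -> H & forall n z,
    rip z x = rip z (y n) + rip (Q n z) (Q n (y n))}.
  apply: (choice (P := fun n y => forall z, rip z x = rip z y + rip (Q n z) (Q n y))) => n.
  have [g hg] := Q_lin n.
  have [||||y hy] := @lax_milgram _ H g (fun z => rip z x) (n2 x) (K ^+ n).
  - by move=> u v; rewrite ripDl.
  - by move=> t u; rewrite ripZl.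
  - by move=> u; have := rip_le u x; have := n2_ge0 u; have := n2_ge0 x; lra.
  - by move=> u; rewrite hg; exact: Q_bnd.
  by exists y => z; rewrite hy !hg.
have xE n : x - y n = Q (n + n) (y n).
  apply/eqP; rewrite subr_eq addrC; apply/eqP; apply: rip_eqr => z.
  by rewrite (hy n) ripDr Q_adj /Q iterD.
have yx n : rip (y n) x = n2 (y n) + n2 (Q n (y n)) by rewrite (hy n).
have yle n : n2 (y n) + n2 (Q n (y n)) <= n2 x.
  by have := rip_le (y n) x; rewrite yx; have := n2_ge0 (Q n (y n)); lra.
have Qle n k : (k <= n)%N -> n2 (Q k (y n)) <= n2 x.
  move=> /(convex_le_ends (Q_convex (y n))) h; have := yle n.
  have := n2_ge0 (Q n (y n)); have := n2_ge0 (y n).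
  by case: h => /= h; move: h; rewrite {1 2}/Q /=; lra.
have [F [FU Foo]] := @ultraFilterLemma nat \oo _.
have [|y0 [_ hy0]] := @ultra_weak_cvg R H nat F FU y (n2 x).
  by apply: nearW => n; have := yle n; have := n2_ge0 (Q n (y n)); lra.
have : M y0.
  exists (n2 x) => k.
  apply: (@wlim_n2 _ nat F _ _ _ _ _ _ (wlim_adj (Q_adj k) hy0)).
  by apply: Foo; exists k => // n /= kn; exact: Qle.
rewrite M0 /= => y00; rewrite {}y00 {y0} in hy0.
have lim0 z : rip (y n) z @[n --> F] --> 0 by rewrite -(rip0l z); exact: hy0.
rewrite leNgt; apply/negP => qx.
have x0 : 0 < n2 x by apply: le_lt_trans qx; exact: n2_ge0.
have : n2 x - n2 (q x) <= 0.
  (* This quantity will dominate n2 x - n2 (q x): expand n2 (x - y) <= n2 (q (x - y)) and use n2 (q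
     y) <= K n2 y <= K rip y x. *)
  have lim1 : (K + 2) * rip (y n) x - 2 * rip (y n) (q (q x)) @[n --> F] --> (0 : R).
    rewrite [X in _ --> X](_ : 0 = (K + 2) * 0 - 2 * 0); last by rewrite !mulr0 subrr.
    by apply: cvgB; apply: cvgM; rewrite ?mulr0; [exact: cvg_cst|exact: lim0|exact: cvg_cst|exact: lim0].
  apply: (cvgr_to_ge lim1).
  have small : \forall n \near F, rip (y n) x < n2 x / 2.
    have x2 : 0 < n2 x / 2 by lra.
    have /cvgrPdist_lt /(_ _ x2) := lim0 x.
    by apply: filterS => n; rewrite sub0r normrN; apply: le_lt_trans; exact: ler_norm.
  apply: filterS small => n sn.
  (* If [q] decreased the norm of x - y = q^(2n) y, convexity would give n2 (x - y) <= n2 y, that is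
     n2 x <= 2 rip y x, against [small]. *)
  have step : n2 (x - y n) <= n2 (q (x - y n)).
    rewrite xE leNgt; apply/negP => /(convex_drop (Q_convex (y n))).
    rewrite -xE n2B (ripC x) /Q /=; lra.
  rewrite opB !n2B q_adj in step.
  have := q_bnd (y n); have := yx n; have := n2_ge0 (Q n (y n)); have := n2_ge0 (y n).
  move: step; rewrite (ripC x (y n)) (ripC x (q (q (y n)))) !q_adj => step h0 h1 h2 h3.
  have h4 : K * n2 (y n) <= K * rip (y n) x by apply: ler_wpM2l => //; lra.
  lra.
lra.
Qed.

(** The reducing subspace [M] is 0 or everything; [q] expands in the first case and contracts in the
    second. *)
Lemma norm_dichotomy : (forall x, n2 (q x) <= n2 x) \/ (forall x, n2 x <= n2 (q x)).
Proof.
have [/expanding h|MT] := T_irr M_reducing (M_stable T_bnd qT) (M_stable T'_bnd qT').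
  by right.
left=> x; have [C hC] : M x by rewrite MT.
exact: (convex_bounded_le (Q_convex x) hC 0).
Qed.

End SelfAdjoint.

Lemma norm_dichotomy_scaled (q : {linear H -> H}) K (r : R) :
  bnd q K -> 0 <= K -> adjp q q ->
  (forall x, q (T x) = T (q x)) -> (forall x, q (T' x) = T' (q x)) -> 0 < r ->
  (forall x, n2 (q x) <= r * n2 x) \/ (forall x, r * n2 x <= n2 (q x)).
Proof.
move=> qK K0 qa qT qT' r0.
pose s := (Num.sqrt r)^-1.
have ss : s ^+ 2 = r^-1 by rewrite exprVn sqr_sqrtr // ltW.
have [p hp] : exists p : {linear H -> H}, forall x, p x = s%:C *: q x.
  apply: linear_pack => a x y.
  by rewrite opD opZ scalerDr !scalerA mulrC.
have pn x : n2 (p x) = r^-1 * n2 (q x) by rewrite hp n2Z ss.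
have [|||||h|h] := @norm_dichotomy p (r^-1 * K).
- by move=> x; rewrite pn -mulrA; apply: ler_wpM2l => //; rewrite invr_ge0 ltW.
- by rewrite mulr_ge0 // invr_ge0 ltW.
- by move=> x y; rewrite !hp ripZl ripZr qa.
- by move=> x; rewrite !hp qT opZ.
- by move=> x; rewrite !hp qT' opZ.
- by left=> x; have := h x; rewrite pn ler_pdivrMl.
- by right=> x; have := h x; rewrite pn ler_pdivlMl.
Qed.

(** If n2 (q u) / n2 u differed from n2 (q v) / n2 v, a number r strictly between them would violate
    the scaled dichotomy. *)
Lemma irr_homothety (q : {linear H -> H}) K :
  bnd q K -> 0 <= K -> adjp q q ->
  (forall x, q (T x) = T (q x)) -> (forall x, q (T' x) = T' (q x)) ->
  exists s, forall x, n2 (q x) = s * n2 x.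
Proof.
move=> qK K0 qa qT qT'.
have [[x0 x00]|h0] := pselect (exists x0 : H, x0 <> 0); last first.
  exists 0 => x; have -> : x = 0 by apply: contrapT => ?; apply: h0; exists x.
  by rewrite op0 n2_0 mulr0.
have p0 := n2_gt0 x00.
have gap (u v : H) : 0 < n2 u -> 0 < n2 v -> ~ (n2 (q u) / n2 u < n2 (q v) / n2 v).
  move=> u0 v0 lt_uv.
  pose r := (n2 (q u) / n2 u + n2 (q v) / n2 v) / 2.
  have ru : n2 (q u) / n2 u < r by rewrite /r; lra.
  have rv : r < n2 (q v) / n2 v by rewrite /r; lra.
  have r0 : 0 < r by apply: le_lt_trans ru; rewrite divr_ge0 // n2_ge0.
  move: ru rv; rewrite ltr_pdivrMr // ltr_pdivlMr // => ru rv.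
  have [h|h] := norm_dichotomy_scaled qK K0 qa qT qT' r0.
    by have := h v; lra.
  by have := h u; lra.
exists (n2 (q x0) / n2 x0) => x.
have [->|/eqP /n2_gt0 px] := eqVneq x 0; first by rewrite op0 n2_0 mulr0.
have <- : n2 (q x) / n2 x = n2 (q x0) / n2 x0.
  apply/eqP; case: (ltgtP (n2 (q x) / n2 x) (n2 (q x0) / n2 x0)) => // h; exfalso.
    exact: gap px p0 h.
  exact: gap p0 px h.
by rewrite divfK // gt_eqF.
Qed.

(* The dichotomy makes [q] and [q + 1] multiples of isometries, and polarizing
   the difference of the two square norms gives [q]. *)
Lemma schur_selfadjoint (q : {linear H -> H}) K :
  bnd q K -> 0 <= K -> adjp q q ->
  (forall x, q (T x) = T (q x)) -> (forall x, q (T' x) = T' (q x)) ->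
  exists c : R, forall x, q x = c%:C *: x.
Proof.
move=> qK K0 qa qT qT'.
have [s hs] := irr_homothety qK K0 qa qT qT'.
have [p hp] : exists p : {linear H -> H}, forall x, p x = q x + x.
  by apply: linear_pack => a x y; rewrite opD opZ scalerDr addrACA.
have [|||||t ht] := @irr_homothety p (2 * K + 2).
- move=> x; rewrite hp; apply: le_trans (n2D_le _ _) _.
  by have := qK x; lra.
- lra.
- by move=> x y; rewrite !hp ripDl ripDr qa.
- by move=> x; rewrite !hp qT opD.
- by move=> x; rewrite !hp qT' opD.
pose c := (t - s - 1) / 2.
have hc x : rip (q x) x = c * n2 x.
  by have := ht x; rewrite hp n2D hs /c; lra.
exists c => x; apply: rip_eq => z; rewrite ripZl.
have := hc (x + z); rewrite opD !ripDl !ripDr !hc n2D (qa z x) (ripC z (q x)); lra.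
Qed.

(** The self-adjoint operators p = A + A' and q = i (A - A') are scalar, and A = (p - i q) / 2. *)
Lemma schur (A A' : {linear H -> H}) K :
  adjp T T' -> bnd A K -> 0 <= K -> adjp A A' ->
  (forall x, A (T x) = T (A x)) -> (forall x, A (T' x) = T' (A x)) ->
  exists c : R[i], forall x, A x = c *: x.
Proof.
move=> TT' AK K0 AA' AT AT'.
have A'K := adjp_bnd K0 AA' AK.
have A'T x : A' (T x) = T (A' x).
  by apply: rip_eqr => z; rewrite -AA' -(adjpC TT') -AT' AA' (adjpC TT').
have A'T' x : A' (T' x) = T' (A' x).
  by apply: rip_eqr => z; rewrite -AA' -TT' -AT AA' TT'.
have [p hp] : exists p : {linear H -> H}, forall x, p x = A x + A' x.
  by apply: linear_pack => a x y; rewrite (opD A) (opD A') (opZ A) (opZ A') scalerDr addrACA.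
have [q hq] : exists q : {linear H -> H}, forall x, q x = iC *: (A x - A' x).
  apply: linear_pack => a x y; rewrite (opD A) (opD A') (opZ A) (opZ A') opprD addrACA -scalerBr scalerDr.
  by rewrite !scalerA mulrC.
have A'A := adjpC AA'.
have [|||||c hc] := @schur_selfadjoint p (4 * K).
- move=> x; rewrite hp; apply: le_trans (n2D_le _ _) _.
  by have := AK x; have := A'K x; lra.
- lra.
- by move=> x y; rewrite !hp ripDl ripDr AA' A'A addrC.
- by move=> x; rewrite !hp AT A'T opD.
- by move=> x; rewrite !hp AT' A'T' opD.
have [|||||d hd] := @schur_selfadjoint q (4 * K).
- move=> x; rewrite hq n2ZC /= expr0n add0r expr1n mul1r.
  apply: le_trans (n2D_le _ _) _; rewrite n2N.
  by have := AK x; have := A'K x; lra.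
- lra.
- move=> x y; rewrite !hq ripZlC ripBl AA' A'A -ripBr.
  by rewrite (opZ A) (opZ A') -scalerBr conj_iC scaleNr -scalerN opprB.
- by move=> x; rewrite !hq AT A'T (opZ T) (opB T).
- by move=> x; rewrite !hq AT' A'T' (opZ T') (opB T').
exists ((2^-1)%:C * (c%:C - iC * d%:C)) => x.
rewrite -scalerA scalerBl -scalerA -hc -hd hp hq.
rewrite (scalerA iC) mul_iC scaleN1r opprK addrACA subrr addr0.
have -> : A x + A x = (2 : R)%:C *: A x.
  by rewrite [(2 : R)%:C]rmorph_nat scaler_nat mulr2n.
by rewrite scalerA -rmorphM mulVf // scale1r.
Qed.

End Dichotomy.

(** * Localization of the intertwiners by the Baire category theorem *)

Section Expi.
Variable R : realType.
Implicit Types (a b : R) (l : R[i]).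

Definition expi a : R[i] := Complex (cos a) (sin a).

Lemma expiD a b : expi (a + b) = expi a * expi b.
Proof. by rewrite /expi cosD sinD; apply/eqP; rewrite eq_complex /= !eqxx addrC eqxx. Qed.

Lemma expi0 : expi 0 = 1.
Proof. by rewrite /expi cos0 sin0. Qed.

Lemma conjc_expi a : conjc (expi a) = expi (- a).
Proof. by rewrite /expi cosN sinN. Qed.

Lemma expi_conj a : expi a * conjc (expi a) = 1.
Proof. by rewrite conjc_expi -expiD subrr expi0. Qed.

Lemma circleP l : circle l <-> l * conjc l = 1.
Proof.
rewrite /circle /= -sqr_normc; split=> [->|h]; first by rewrite expr1n.
by apply/eqP; rewrite -(@eqrXn2 _ 2) // h expr1n.
Qed.

Lemma circle_expi a : circle (expi a).
Proof. exact/circleP/expi_conj. Qed.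

(** A nonnegative angle can later be approximated by natural multiples of small angles; on the lower
    half circle it is 2 pi - acos u. *)
Lemma circle_ex l : circle l -> exists a, 0 <= a /\ l = expi a.
Proof.
move=> /circleP; case: l => u v; rewrite /= => -[h _].
have {}h : u ^+ 2 + v ^+ 2 = 1 by rewrite -h; ring.
have hu : -1 <= u <= 1 by apply/andP; split; nra.
have cu : cos (acos u) = u by rewrite acosK.
have su : sin (acos u) = Num.sqrt (v ^+ 2) by rewrite sin_acos // -h addrAC subrr add0r.
have [v0|v0] := lerP 0 v.
  exists (acos u); split; first exact: acos_ge0.
  by rewrite /expi cu su sqrtr_sqr ger0_norm.
exists (- acos u + pi *+ 2); split.
  by have := acos_lepi hu; have := pi_ge0 R; lra.
by rewrite /expi cosD2pi sinD2pi cosN sinN cu su sqrtr_sqr ltr0_norm // opprK.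
Qed.

End Expi.

Section InterAlgebra.
Variable R : realType.

Lemma inter_comp (H1 H2 H3 : hilbertType R) (T1 T1' : {linear H1 -> H1})
    (T2 T2' : {linear H2 -> H2}) (T3 T3' : {linear H3 -> H3}) (l m : R[i])
    (A : H1 -> H2) (B : {linear H2 -> H3}) :
  inter T1 T1' T2 T2' l A -> inter T2 T2' T3 T3' m B ->
  inter T1 T1' T3 T3' (l * m) (B \o A).
Proof.
move=> [cA A1 A1'] [cB B1 B1']; split => x /=.
- exact: le_trans (cB _) (cA _).
- by rewrite A1 opZ B1 scalerA.
- by rewrite A1' opZ B1' scalerA rmorphM.
Qed.

(** Each relation for [B] is the adjoint of the relation for [A] with the other operator; l * conjc
    l = 1 moves the scalar across. *)
Lemma inter_adj (H1 H2 : hilbertType R) (T1 T1' : {linear H1 -> H1})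
    (T2 T2' : {linear H2 -> H2}) (l : R[i]) (A : {linear H1 -> H2}) (B : {linear H2 -> H1}) :
  adjp T1 T1' -> adjp T2 T2' -> l * conjc l = 1 -> adjp A B ->
  inter T1 T1' T2 T2' l A -> inter T2 T2' T1 T1' (conjc l) B.
Proof.
move=> a1 a2 l1 AB [cA A1 A1']; split.
- exact: adjp_contr AB cA.
- move=> y; apply: rip_eqr => z.
  have e : T2' (A z) = l *: A (T1' z) by rewrite A1' scalerA l1 scale1r.
  by rewrite -AB -(adjpC a2) e ripZlC AB opZ (adjpC a1) opZ.
- move=> y; apply: rip_eqr => z.
  have e : T2 (A z) = conjc l *: A (T1 z) by rewrite A1 scalerA mulrC l1 scale1r.
  by rewrite -AB -a2 e ripZlC AB opZ a1 opZ.
Qed.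

Lemma inter1_scalar (H : hilbertType R) (T T' : {linear H -> H}) (KT KT' : R)
    (A : {linear H -> H}) :
  adjp T T' -> bnd T KT -> bnd T' KT' -> irr T T' -> inter T T' T T' 1 A ->
  exists c : R[i], forall x, A x = c *: x.
Proof.
move=> a bT bT' iT [cA A1 A1'].
have bA : bnd A 1 by move=> x; rewrite mul1r.
have [B AB] := adjp_ex bA.
apply: (schur bT bT' iT a bA ler01 AB) => x.
  by rewrite A1 scale1r.
by rewrite A1' rmorph1 scale1r.
Qed.

End InterAlgebra.

Lemma baire_interval (R : realType) (F : nat -> set R) :
  (forall n, closed (F n)) -> (forall t, exists n, F n t) ->
  exists n t0 d, 0 < d /\ forall t, `|t - t0| < d -> F n t.
Proof.
move=> cF covF; apply: contrapT => hn.
have : dense (\bigcap_n (~` F n)).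
  apply: (@Baire R R^o) => n; split; first exact/closed_openC/cF.
  move=> O [t Ot] oO; apply: contrapT => hO; apply: hn.
  have /nbhs_ballP[d /= d0 hd] : nbhs t O by exact: open_nbhs_nbhs.
  exists n, t, d; split => // s st; apply: contrapT => ns.
  by apply: hO; exists s; split => //; apply: hd; rewrite -ball_normE /= distrC.
move=> /(_ setT) [|//|t [_ ht]]; first by exists 0.
  exact: openT.
by have [n Fnt] := covF t; exact: ht n I Fnt.
Qed.

Section Unitary.
Variables (R : realType) (H : hilbertType R) (U : {linear H -> H}).
Hypothesis U_unitary : unitary U.

Lemma unitary_inverse : exists U' : {linear H -> H},
  [/\ adjp U U', forall x, U' (U x) = x & forall x, U (U' x) = x].
Proof.
have [bU U1 U2] := U_unitary.
have [K _ bK] := bounded_bnd bU.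
have [U' UU'] := adjp_ex bK.
exists U'; split => // x.
  by rewrite -[RHS]U1 (adjp_adjoint UU').
by rewrite -[RHS]U2 (adjp_adjoint UU').
Qed.

Lemma unitary_n2 x : n2 (U x) = n2 x.
Proof. by have [U' [UU' U1 _]] := unitary_inverse; rewrite /n2 UU' U1. Qed.

End Unitary.

Section Decomposition.
Variables (R : realType) (H : hilbertType R) (J : countType).
Variables (Hs : J -> hilbertType R) (V : forall j, {linear Hs j -> H}).
Hypothesis V_dec : orthogonal_decomposition V.

Lemma V_rip j x y : rip (V j x) (V j y) = rip x y.
Proof. by rewrite /rip; have [-> _ _] := V_dec. Qed.

Lemma V_n2 j x : n2 (V j x) = n2 x.
Proof. exact: V_rip. Qed.

Lemma V_contr j : contr (V j).
Proof. by move=> x; rewrite V_n2. Qed.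

Lemma V_bnd j : bnd (V j) 1.
Proof. by move=> x; rewrite V_n2 mul1r. Qed.

Lemma V_orth j k x y : j <> k -> rip (V j x) (V k y) = 0.
Proof. by move=> jk; rewrite /rip; have [_ -> //] := V_dec. Qed.

Lemma V_adj : exists V' : forall j, {linear H -> Hs j}, forall j, adjp (V j) (V' j).
Proof.
exists (fun j => projT1 (cid (adjp_ex (@V_bnd j)))) => j.
exact: (projT2 (cid (adjp_ex (@V_bnd j)))).
Qed.

(** The vector z - w is orthogonal to all finite sums, so by Pythagoras no such sum is closer to it
    than 0 is. *)
Lemma V_dense_eq z w : (forall j u, rip (V j u) z = rip (V j u) w) -> z = w.
Proof.
move=> h; apply/eqP; rewrite -subr_eq0; apply/eqP/n2_eq0/eqP.
rewrite eq_le n2_ge0 andbT leNgt; apply/negP => p.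
have [_ _ /dense_n2 /(_ (z - w) _ p) [_ [s [x ->]]]] := V_dec.
rewrite n2B; have -> : rip (\sum_(j <- s) V j (x j)) (z - w) = 0.
  elim: s => [|j s IH]; first by rewrite big_nil rip0l.
  by rewrite big_cons ripDl IH addr0 ripBr h subrr.
have := n2_ge0 (\sum_(j <- s) V j (x j)); lra.
Qed.

Variables (T T' : {linear H -> H}) (Ts Ts' : forall j, {linear Hs j -> Hs j}).
Hypotheses (T_adj : adjp T T') (Ts_adj : forall j, adjp (Ts j) (Ts' j)).
Hypothesis TV : forall j x, T (V j x) = V j (Ts j x).

Lemma V_inter j : inter (Ts j) (Ts' j) T T' 1 (V j).
Proof.
split; first exact: V_contr.
- by move=> x; rewrite scale1r TV.
- move=> x; rewrite rmorph1 scale1r; apply: V_dense_eq => k u.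
  rewrite -T_adj TV; have [e|/eqP ne] := eqVneq k j.
    by case: _ / e x => x; rewrite !V_rip Ts_adj.
  by rewrite !V_orth.
Qed.

(** Multiplying U T = l T U by the inverse [U'] on both sides gives T U' = l U' T, whose adjoint is
    the relation with [T']. *)
Lemma unitary_inter (l : R[i]) (U : {linear H -> H}) :
  unitary U -> (forall x, U (T x) = l *: T (U x)) -> inter T T' T T' l U.
Proof.
move=> uU UT; have [U' [UU' U1 U2]] := unitary_inverse uU.
split => //.
- by move=> x; rewrite unitary_n2.
- move=> x; apply: rip_eqr => z.
  have e : T (U' z) = l *: U' (T z) by rewrite -{2}[z]U2 -[in RHS]opZ -UT U1.
  by rewrite -(adjpC UU') -T_adj e ripZlC (adjpC UU') opZ T_adj opZ.
Qed.

Hypothesis T_circ : circular T.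
Hypothesis H_sep : separable H.

Section Summand.
Variables (j : J) (x : Hs j).
Hypothesis x0 : x <> 0.

(** The radius |z| / 4 is relative to z, so that two images within it have an inner product bounded
    below by a multiple of n2 z. *)
Let K (k : J) (z : H) : set R := [set t | 0 < n2 z /\
  exists A : {linear Hs j -> Hs k},
    inter (Ts j) (Ts' j) (Ts k) (Ts' k) (expi t) A /\ n2 (V k (A x) - z) <= n2 z / 16].

(** Along an ultrafilter on [K k z] converging to t, the chosen contractions have a weak limit, an
    intertwiner for t; weak lower semicontinuity keeps the distance bound. *)
Let K_closed k z : closed (K k z).
Proof.
move=> t clt.
have Kz : 0 < n2 z by have [|s [[]]] := clt setT; first exact: filterT.
have wF : ProperFilter (within (K k z) (nbhs t)) by apply: within_nbhs_proper; exact: clt.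
have [G [GU wG]] := ultraFilterLemma wF.
have GK : G (K k z) by apply: wG; rewrite /within /=; exact: nearW.
have Gt : nbhs t `<=` G.
  by move=> U tU; apply: wG; rewrite /within /=; apply: filterS tU => s + _.
have [A hA] : {A : R -> {linear Hs j -> Hs k} & forall s, K k z s ->
    inter (Ts j) (Ts' j) (Ts k) (Ts' k) (expi s) (A s) /\ n2 (V k (A s x) - z) <= n2 z / 16}.
  apply: (choice (P := fun s (A : {linear Hs j -> Hs k}) => K k z s ->
    inter (Ts j) (Ts' j) (Ts k) (Ts' k) (expi s) A /\ n2 (V k (A x) - z) <= n2 z / 16)) => s.
  by have [[_ [A hA]]|ns] := pselect (K k z s); [exists A | exists (GRing.null_fun _)].
have [|B [cB hB]] := @ultra_wlim_op R (Hs j) (Hs k) R G GU (fun s => A s).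
  apply: filterS GK => s /hA [[cA _ _] _]; split => //.
  by move=> a u v; rewrite opD opZ.
split=> //; exists B; split.
  have iA : \forall s \near G, inter (Ts j) (Ts' j) (Ts k) (Ts' k) (expi s) (A s).
    by apply: filterS GK => s /hA [].
  apply: (inter_wlim _ (@Ts_adj k) _ _ iA cB hB).
  - by move=> U /continuous_cos; exact: Gt.
  - by move=> U /continuous_sin; exact: Gt.
have [V' hV'] := V_adj.
apply: (@wlim_n2 _ _ G _ _ (fun s => V k (A s x) - z)).
  by apply: filterS GK => s /hA [].
apply: wlimD; last exact: wlim_cst.
exact: wlim_adj (hV' k) (hB x).
Qed.

Lemma summand_local_inter : exists c d : R, [/\ 0 < c, 0 < d &
  forall t, `|t| < d -> exists B : {linear Hs j -> Hs j},
    inter (Ts j) (Ts' j) (Ts j) (Ts' j) (expi t) B /\ c <= rip (B x) x].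
Proof.
have [S /countable_injP [f f_inj] /dense_n2 S_dense] := H_sep.
(* The pairs (k, z), with z in the countable dense set, are coded by natural numbers; [F p] is empty
   when p is not a code. *)
pose F (p : nat) := [set t | exists (k : J) (z : H),
  [/\ S z, p = pickle (pickle k, f z) & K k z t]].
have F_closed p : closed (F p).
  have [[k [z [Sz pE]]]|hn] := pselect (exists (k : J) (z : H), S z /\ p = pickle (pickle k, f z)).
    suff -> : F p = K k z by exact: K_closed.
    apply/seteqP; split=> t; last by exists k, z.
    move=> [k' [z' [Sz']]]; rewrite pE => /(pcan_inj pickleK) [].
    by move=> /(pcan_inj pickleK) <- /f_inj <-; rewrite ?inE.
  suff -> : F p = set0 by exact: closed0.
  by apply/seteqP; split=> t //; case=> k [z [Sz pE _]]; apply: hn; exists k, z.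
have F_cover t : exists p, F p t.
  have [U [uU UT]] := T_circ (circle_expi t).
  have iU := unitary_inter uU UT.
  have [V' hV'] := V_adj.
  have [[k Ak0]|hn] := pselect (exists k, V' k (U (V j x)) <> 0).
    pose u := V k (V' k (U (V j x))).
    have u0 : 0 < n2 u by rewrite V_n2; exact: n2_gt0.
    (* If n2 (z - u) < n2 u / 64 then n2 z > 31/64 n2 u, so z is nonzero and n2 u / 64 < n2 z /
       16. *)
    have u64 : 0 < n2 u / 64 by lra.
    have [z Sz zu] := S_dense u _ u64.
    have h : n2 u <= 2 * n2 (z - u) + 2 * n2 z.
      by rewrite -{1}(subKr z u) -(n2N (z - u)) addrC; exact: n2D_le.
    exists (pickle (pickle k, f z)), k, z; split => //; split; first by lra.
    exists (V' k \o U \o V j)%FUN; split; last first.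
      by rewrite /= -/u -n2N opprB; lra.
    have c1 : 1 * conjc 1 = 1 :> R[i] by rewrite rmorph1 mulr1.
    have := inter_comp (inter_comp (V_inter j) iU)
      (inter_adj (@Ts_adj k) T_adj c1 (hV' k) (V_inter k)).
    by rewrite mul1r rmorph1 mulr1.
  (* If every component of U (V j x) vanished, the unitary [U] would kill V j x. *)
  exfalso; apply: x0; apply: n2_eq0; rewrite -(V_n2 (j := j)).
  rewrite -(unitary_n2 uU).
  suff -> : U (V j x) = 0 by rewrite n2_0.
  apply: V_dense_eq => k u; rewrite rip0r (hV' k).
  suff -> : V' k (U (V j x)) = 0 by rewrite rip0r.
  by apply: contrapT => ?; apply: hn; exists k.
have [p [t0 [d [d0 hd]]]] := baire_interval F_closed F_cover.
have [|k [z [Sz pE [z0 [A0 [iA0 A0z]]]]]] := hd t0.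
  by rewrite subrr normr0.
exists (n2 z / 4), d; split => //; first by lra.
move=> t td; have [|k' [z' [Sz']]] := hd (t0 + t).
  by rewrite addrAC subrr add0r.
rewrite pE => /(pcan_inj pickleK) [] /(pcan_inj pickleK) ek /f_inj; rewrite !inE => ez.
have {ez} ez := ez Sz Sz'; subst k' z'.
move=> [_ [A [iA Az]]].
have bA0 : bnd A0 1 by case: iA0 => cA0 _ _ y; rewrite mul1r.
have [B0 hB0] := adjp_ex bA0.
(* [B0] is the adjoint of [A0]; the angles t0 + t and - t0 add up to t. *)
exists (B0 \o A)%FUN; split.
  have := inter_comp iA (inter_adj (@Ts_adj j) (@Ts_adj k) (expi_conj t0) hB0 iA0).
  by rewrite conjc_expi -expiD addrAC subrr add0r.
rewrite /= (adjpC hB0) -(V_rip (A x)).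
move: Az A0z; set u := V k (A x); set v := V k (A0 x) => uz vz.
(* Expand rip u v around z. The weight 4 bounds each of rip (u - z) z and rip (v - z) z below by -
   n2 z / 4, and the product of errors is at least - n2 z / 16. *)
have h1 := rip_le (u - z) (- (v - z)).
have h2 := rip_le (- (4%:C *: (u - z))) z.
have h3 := rip_le (- (4%:C *: (v - z))) z.
move: h1 h2 h3; rewrite !n2N !n2Z !ripNr !ripNl !ripZl !ripBl !ripBr -/(n2 z) (ripC z v).
lra.
Qed.

End Summand.
End Decomposition.

(** * Unitary intertwiners and finite Fourier analysis *)

Lemma conjc_eq1 (R : realType) (a : R[i]) : (conjc a == 1) = (a == 1).
Proof. by rewrite -[in LHS](@conjc1 R) (inj_eq (can_inj (@conjcK R))). Qed.

Section Nsq.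
Variable R : realType.
Implicit Types (a b : R[i]).

Definition nsq a : R := complex.Re a ^+ 2 + complex.Im a ^+ 2.

Lemma nsqE a : (nsq a)%:C = a * conjc a.
Proof. by rewrite -sqr_normc -add_Re2_Im2. Qed.

Lemma nsq_ge0 a : 0 <= nsq a.
Proof. by rewrite addr_ge0 ?sqr_ge0. Qed.

Lemma nsqM a b : nsq (a * b) = nsq a * nsq b.
Proof. by apply: complexI; rewrite rmorphM /= !nsqE rmorphM /= mulrACA. Qed.

Lemma nsq_expi (t : R) : nsq (expi t) = 1.
Proof. by rewrite /nsq /= cos2Dsin2. Qed.

Lemma Re_le_nsq a : complex.Re a ^+ 2 <= nsq a.
Proof. by rewrite lerDl sqr_ge0. Qed.

Lemma n2_scale (H : hilbertType R) a (x : H) : n2 (a *: x) = nsq a * n2 x.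
Proof. exact: n2ZC. Qed.

Lemma nsq1_expi a : nsq a = 1 -> exists t, a = expi t.
Proof. by move=> a1; have [|t [_ ->]] := @circle_ex _ a; [apply/circleP; rewrite -nsqE a1 | exists t]. Qed.

End Nsq.

Section Uint.
Variables (R : realType) (H : hilbertType R) (T T' : {linear H -> H}).
Variables (KT KT' : R).
Hypotheses (T_adj : adjp T T') (T_bnd : bnd T KT) (T'_bnd : bnd T' KT').
Hypothesis T_irr : irr T T'.
Implicit Types (U W A : {linear H -> H}) (l m : R[i]).

Notation interT := (inter T T' T T').

Definition uint l U U' :=
  [/\ adjp U U', forall x, U' (U x) = x, forall x, U (U' x) = x & interT l U].

Lemma uint_n2 l U U' : uint l U U' -> forall x, n2 (U x) = n2 x.
Proof. by case=> UU' U1 _ _ x; rewrite /n2 UU' U1. Qed.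

Lemma uint1 : uint 1 idfun idfun.
Proof.
split => //; split => x; [exact: lexx|by rewrite scale1r|].
by rewrite rmorph1 scale1r.
Qed.

Lemma uint_comp l m U U' W W' : uint l U U' -> uint m W W' ->
  uint (l * m) (W \o U)%FUN (U' \o W')%FUN.
Proof.
move=> [UU' U1 U2 iU] [WW' W1 W2 iW]; split.
- exact: adjp_comp.
- by move=> x /=; rewrite W1 U1.
- by move=> x /=; rewrite U2 W2.
- exact: inter_comp iU iW.
Qed.

Lemma uint_iter l U U' n : uint l U U' ->
  exists W W', uint (l ^+ n) W W' /\ forall x, W x = iter n U x.
Proof.
move=> uU; elim: n => [|n [W [W' [uW WE]]]].
  by exists idfun, idfun; split; first exact: uint1.
exists (U \o W)%FUN, (W' \o U')%FUN; split; last by move=> x /=; rewrite WE.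
by rewrite exprSr; exact: uint_comp.
Qed.

Lemma uintZ l U U' t : uint l U U' ->
  exists W W', uint l W W' /\ forall x, W x = expi t *: U x.
Proof.
move=> [UU' U1 U2 [cU UT UT']].
have [W hW] : exists W : {linear H -> H}, forall x, W x = expi t *: U x.
  by apply: linear_pack => a x y; rewrite (opD U) (opZ U) scalerDr !scalerA mulrC.
have [W' hW'] : exists W' : {linear H -> H}, forall x, W' x = conjc (expi t) *: U' x.
  by apply: linear_pack => a x y; rewrite (opD U') (opZ U') scalerDr !scalerA mulrC.
exists W, W'; split => //; split.
- by move=> x y; rewrite hW hW' ripZlC UU' (opZ U').
- by move=> x; rewrite hW' hW (opZ U') U1 scalerA mulrC expi_conj scale1r.
- by move=> x; rewrite hW hW' (opZ U) U2 scalerA expi_conj scale1r.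
- split.
  + by move=> x; rewrite hW n2_scale nsq_expi mul1r.
  + by move=> x; rewrite !hW UT (opZ T) !scalerA mulrC.
  + by move=> x; rewrite !hW UT' (opZ T') !scalerA mulrC.
Qed.

(** Schur's lemma applies to U' A, an intertwiner for 1. *)
Lemma uint_unique l U U' A : l * conjc l = 1 -> uint l U U' -> interT l A ->
  exists a : R[i], forall x, A x = a *: U x.
Proof.
move=> l1 [UU' U1 U2 iU] iA.
have iU' := inter_adj T_adj T_adj l1 UU' iU.
have := inter_comp iA iU'; rewrite l1 => i1.
have [a ha] := inter1_scalar T_adj T_bnd T'_bnd T_irr (A := (U' \o A)%FUN) i1.
by exists a => x; rewrite -opZ -ha /= U2.
Qed.

(** With [B] the adjoint of [A], Schur's lemma makes B A and A B scalars s and s'. They agree since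
    A B A u has both values, and A / sqrt s is unitary. *)
Lemma inter_uint l A u : l * conjc l = 1 -> interT l A -> A u <> 0 ->
  exists U U', uint l U U'.
Proof.
move=> l1 iA Au; have [cA AT AT'] := iA.
have bA : bnd A 1 by move=> x; rewrite mul1r.
have [B AB] := adjp_ex bA.
have BA := adjpC AB.
have cB := adjp_contr AB cA.
have iB := inter_adj T_adj T_adj l1 AB iA.
have l1' : conjc l * l = 1 by rewrite mulrC.
have scal (q : {linear H -> H}) : contr q -> interT 1 q -> adjp q q ->
    exists s : R, forall x, q x = s%:C *: x.
  move=> cq [_ qT qT'] qa; apply: (schur_selfadjoint T_bnd T'_bnd T_irr _ ler01 qa).
  - by move=> x; rewrite mul1r.
  - by move=> x; rewrite qT scale1r.
  - by move=> x; rewrite qT' rmorph1 scale1r.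
have [|||s hs] := scal (B \o A)%FUN.
- by move=> x; exact: le_trans (cB _) (cA _).
- by have := inter_comp iA iB; rewrite l1.
- by move=> x y /=; rewrite BA AB.
have [|||s' hs'] := scal (A \o B)%FUN.
- by move=> x; exact: le_trans (cA _) (cB _).
- by have := inter_comp iB iA; rewrite l1'.
- by move=> x y /=; rewrite AB BA.
have ss' : s' = s.
  have : (s' - s)%:C *: A u = 0.
    by rewrite rmorphB scalerBl -hs' /= -opZ -hs subrr.
  move=> /eqP; rewrite scaler_eq0 => /orP[/eqP [] /eqP|/eqP//].
  by rewrite subr_eq0 => /eqP.
have u0 : u <> 0 by move=> u0; apply: Au; rewrite u0 op0.
have nA x : n2 (A x) = s * n2 x by rewrite {1}/n2 AB [B _]hs ripZr.
have s0 : 0 < s by rewrite -(pmulr_lgt0 _ (n2_gt0 u0)) -nA; exact: n2_gt0.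
pose r := (Num.sqrt s)^-1.
have rr : r * r * s = 1.
  by rewrite -expr2 exprVn sqr_sqrtr ?ltW // mulVf // gt_eqF.
have [U hU] : exists U : {linear H -> H}, forall x, U x = r%:C *: A x.
  by apply: linear_pack => a x y; rewrite (opD A) (opZ A) scalerDr !scalerA mulrC.
have [U' hU'] : exists U' : {linear H -> H}, forall x, U' x = r%:C *: B x.
  by apply: linear_pack => a x y; rewrite (opD B) (opZ B) scalerDr !scalerA mulrC.
exists U, U'; split.
- by move=> x y; rewrite hU hU' ripZl ripZr AB.
- by move=> x; rewrite hU' hU (opZ B) [B _]hs !scalerA -!rmorphM rr scale1r.
- by move=> x; rewrite hU hU' (opZ A) [A (B x)]hs' ss' !scalerA -!rmorphM rr scale1r.
- split.
  + by move=> x; rewrite hU n2Z nA mulrA expr2 rr mul1r.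
  + by move=> x; rewrite !hU AT (opZ T) !scalerA mulrC.
  + by move=> x; rewrite !hU AT' (opZ T') !scalerA mulrC.
Qed.

End Uint.

Section Fourier.
Variables (R : realType) (H : hilbertType R) (U U' : {linear H -> H}) (N : nat).
Hypotheses (UU' : adjp U U') (U'U : forall x, U' (U x) = x).
Hypotheses (N0 : (0 < N)%N) (UN : forall x, iter N U x = x).

Let z (k : nat) : R[i] := expi (k%:R * (2 * pi / N%:R)).

Let zD k l : z (k + l) = z k * z l.
Proof. by rewrite /z natrD mulrDl expiD. Qed.

Let z_conj k : z k * conjc (z k) = 1.
Proof. exact: expi_conj. Qed.

Let z0 : z 0 = 1.
Proof. by rewrite /z mul0r expi0. Qed.

Let zN : z N = 1.
Proof.
rewrite /z mulrC divfK ?pnatr_eq0 -?lt0n //.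
by rewrite mulr_natl /expi cos2pi sin2pi.
Qed.

Let zNM k : z (k * N) = 1.
Proof. by elim: k => [|k IH]; rewrite ?mul0n ?z0 // mulSn zD zN IH mul1r. Qed.

Let z_neq1 k : (0 < k < N)%N -> z k != 1.
Proof.
move=> /andP[k0 kN]; apply/eqP => -[c1 _].
pose t : R := k%:R * pi / N%:R.
have Np : 0 < N%:R :> R by rewrite ltr0n.
have t0 : 0 < t by rewrite divr_gt0 // mulr_gt0 ?pi_gt0 // ltr0n.
have tpi : t < pi by rewrite ltr_pdivrMr // mulrC ltr_pM2l ?pi_gt0 // ltr_nat.
have : 0 < sin t by rewrite sin_gt0_pi // t0.
have e : k%:R * (2 * pi / N%:R) = t + t by rewrite /t; field; rewrite gt_eqF.
move: c1; rewrite e cosD; have := cos2Dsin2 t; nra.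
Qed.

Let sum_z l : (l < N)%N -> \sum_(k < N) conjc (z (k * l)) = if l == 0%N then N%:R else 0.
Proof.
case: l => [|l] lN.
  rewrite (eq_bigr (fun=> 1)) ?sumr_const ?card_ord // => k _.
  by rewrite muln0 z0 conjc1.
set w := conjc (z l.+1).
have zX k : z (k * l.+1) = z l.+1 ^+ k.
  by elim: k => [|k IH]; rewrite ?mul0n ?z0 // mulSn zD IH exprS.
have w1 : w - 1 != 0.
  by rewrite subr_eq0 conjc_eq1; exact: z_neq1.
apply: (mulfI w1); rewrite mulr0.
rewrite (eq_bigr (fun k : 'I_N => w ^+ k)); last by move=> k _; rewrite zX rmorphXn.
by rewrite -subrX1 -rmorphXn -zX mulnC zNM rmorph1 subrr.
Qed.

Variable x : H.

(** As U^N = 1, this is the spectral projection of [x] for the eigenvalue [z k], a discrete Fourier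
    coefficient of the orbit. *)
Let E (k : nat) : H := (N%:R^-1)%:C *: \sum_(l < N) conjc (z (k * l)) *: iter l U x.

Let NC : (N%:R^-1)%:C * (N%:R : R[i]) = 1.
Proof.
by rewrite -[N%:R : R[i]](rmorph_nat (real_complex R)) -rmorphM /= mulVf // pnatr_eq0 -lt0n.
Qed.

Let U_E k : U (E k) = z k *: E k.
Proof.
pose g l := conjc (z (k * l)) *: iter l U x.
have Ug l : U (g l) = z k *: g l.+1.
  rewrite /g (opZ U) scalerA mulnSr zD rmorphM mulrCA z_conj mulr1.
  by [].
have gN : g N = g 0.
  by rewrite /g zNM UN muln0 z0.
have shift : \sum_(l < N) g l.+1 = \sum_(l < N) g l.
  have := big_ord_recl N (fun l : 'I_N.+1 => g l) (op := +%R) (idx := 0).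
  rewrite big_ord_recr /= gN addrC => /addrI ->.
  by apply: eq_bigr.
rewrite /E (opZ U) scalerA mulrC -scalerA; congr (_ *: _).
rewrite linear_sum scaler_sumr -scaler_sumr -shift scaler_sumr.
by apply: eq_bigr => l _; exact: Ug.
Qed.

Let sum_E : \sum_(k < N) E k = x.
Proof.
rewrite -scaler_sumr exchange_big /=.
under eq_bigr => l _ do rewrite -scaler_suml sum_z ?ltn_ord //.
case: N N0 NC => // n _ nC; rewrite big_ord_recl /= big1 ?addr0.
  by rewrite scalerA nC scale1r.
by move=> l _; rewrite scale0r.
Qed.

Let iter_x l : iter l U x = \sum_(k < N) z (k * l) *: E k.
Proof.
elim: l => [|l IH].
  by rewrite -[LHS]sum_E; apply: eq_bigr => k _; rewrite muln0 z0 scale1r.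
rewrite iterS IH linear_sum; apply: eq_bigr => k _.
by rewrite (opZ U) U_E scalerA mulnSr zD.
Qed.

Let E_orth k k' : (k < N)%N -> (k' < N)%N -> k != k' -> inner (E k) (E k') = 0.
Proof.
wlog lt_kk : k k' / (k < k')%N => [hw|] kN kN' ne.
  move: (ne); rewrite neq_ltn => /orP[lt|lt]; first exact: hw.
  by rewrite innerC hw ?conjc0 // eq_sym.
have : inner (U (E k)) (U (E k')) = inner (E k) (E k').
  by rewrite (adjp_inner UU') U'U.
rewrite !U_E innerZl innerZr mulrA => /eqP.
rewrite -subr_eq0 -[X in _ - X]mul1r -mulrBl mulf_eq0 => /orP[|/eqP//].
rewrite subr_eq0 -{1}(subnKC (ltnW lt_kk)) zD rmorphM mulrA z_conj mul1r.
rewrite conjc_eq1 (negbTE (z_neq1 _)) //.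
by rewrite subn_gt0 lt_kk (leq_ltn_trans (leq_subr _ _)).
Qed.

Let inner_E (k : 'I_N) : inner (E k) x = (n2 (E k))%:C.
Proof.
rewrite -[X in inner _ X]sum_E inner_sumr (bigD1 k) //= inner_n2 big1 ?addr0 //.
by move=> k' ne; rewrite E_orth // eq_sym.
Qed.

Let sum_n2E : \sum_(k < N) n2 (E k) = n2 x.
Proof.
apply: complexI; rewrite -inner_n2 -[X in inner X _]sum_E inner_suml rmorph_sum.
by apply: eq_bigr => k _; exact/esym/inner_E.
Qed.

(** The numbers n2 (E k) are the Fourier coefficients on Z/N of l |-> inner (U^l x) x. *)
Lemma parseval : \sum_(l < N) nsq (inner (iter l U x) x) =
  N%:R * \sum_(k < N) n2 (E k) ^+ 2.
Proof.
apply: complexI; rewrite rmorphM rmorph_nat !rmorph_sum /=.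
have fE l : conjc (inner (iter l U x) x) = \sum_(k < N) conjc (z (k * l)) * (n2 (E k))%:C.
  rewrite iter_x inner_suml rmorph_sum; apply: eq_bigr => k _.
  by rewrite innerZl inner_E rmorphM; congr (_ * _); exact: conjc_real.
under eq_bigr => l _ do rewrite nsqE fE mulr_sumr.
rewrite exchange_big mulr_sumr; apply: eq_bigr => k _ /=.
rewrite rmorphXn expr2 mulrA.
have -> : (N%:R * (n2 (E k))%:C : R[i]) = \sum_(l < N) conjc (z (k * l)) * inner (iter l U x) x.
  rewrite -inner_E /E innerZl mulrA [N%:R * _]mulrC NC mul1r inner_suml.
  by apply: eq_bigr => l _; rewrite innerZl.
rewrite mulr_suml; apply: eq_bigr => l _.
by rewrite mulrA; congr (_ * _); rewrite mulrC.
Qed.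

(* Otherwise all the masses [n2 (E k)], of total [n2 x], are less than [e], and
   [parseval] contradicts the hypothesis. *)
Lemma large_eigenvector (e : R) : 0 < n2 x -> 0 < e ->
  2 * (N%:R * (e * n2 x)) <= \sum_(l < N) nsq (inner (iter l U x) x) ->
  exists y (a : R[i]), [/\ U y = a *: y, n2 y <= n2 x & e <= rip y x].
Proof.
move=> x0 e0 he.
have [[k hk]|hn] := pselect (exists k : 'I_N, e <= n2 (E k)).
  exists (E k), (z k); split; first exact: U_E.
    rewrite -sum_n2E (bigD1 k) //= lerDl sumr_ge0 // => i _; exact: n2_ge0.
  by rewrite /rip inner_E.
have lt_e (k : 'I_N) : n2 (E k) < e.
  by rewrite ltNge; apply/negP => h; apply: hn; exists k.
move: he; rewrite parseval.
have : \sum_(k < N) n2 (E k) ^+ 2 <= e * n2 x.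
  rewrite -sum_n2E mulr_sumr; apply: ler_sum => k _; rewrite expr2.
  by apply: ler_wpM2r; [exact: n2_ge0 | exact/ltW].
have Np : 0 < N%:R :> R by rewrite ltr0n.
rewrite -(ler_pM2l Np); have : 0 < N%:R * (e * n2 x) by rewrite !mulr_gt0.
lra.
Qed.

End Fourier.

(** * A vector fixed by intertwiners for all of the circle *)

Lemma expiX (R : realType) (t : R) n : expi t ^+ n = expi (n%:R * t).
Proof.
elim: n => [|n IH]; first by rewrite mul0r expi0.
by rewrite exprS IH -expiD -nat1r mulrDl mul1r.
Qed.

Lemma sum_ord_prefix (R : realType) (F : nat -> R) (e : R) m N :
  (m <= N)%N -> (forall l, 0 <= F l) -> (forall l, (l < m)%N -> e <= F l) ->
  m%:R * e <= \sum_(l < N) F l.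
Proof.
move=> /subnKC <- F0 Fe; elim: (N - m)%N => [|r IH].
  rewrite addn0; apply: (@le_trans _ _ (\sum_(l < m) e)).
    by rewrite sumr_const card_ord mulr_natl.
  by apply: ler_sum => l _; exact: Fe.
by rewrite addnS big_ord_recr /=; have := F0 (m + r)%N; lra.
Qed.

Section CommonEigenvector.
Variables (R : realType) (H : hilbertType R) (T T' : {linear H -> H}).
Variables (KT KT' : R).
Hypotheses (T_adj : adjp T T') (T_bnd : bnd T KT) (T'_bnd : bnd T' KT').
Hypothesis T_irr : irr T T'.
Variables (x : H) (c d : R).
Hypotheses (c0 : 0 < c) (d0 : 0 < d).
Hypothesis local_inter : forall t, `|t| < d -> exists B : {linear H -> H},
  inter T T' T T' (expi t) B /\ c <= rip (B x) x.

Local Notation interT := (inter T T' T T').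
Local Notation uintT := (uint T T').

Let x_gt0 : 0 < n2 x.
Proof.
have [|B [_ hB]] := local_inter (t := 0); first by rewrite normr0.
by apply: n2_gt0 => x0; move: hB; rewrite x0 rip0r leNgt c0.
Qed.

(** Divide t into n + 1 steps shorter than [d], normalize a local intertwiner for one step, and take
    its power. *)
Let uint_all t : exists U U', uintT (expi t) U U'.
Proof.
pose n := Num.bound (`|t| / d).
have hn : `|t| / d < n.+1%:R.
  have h : 0 <= `|t| / d by rewrite divr_ge0 // ltW.
  by apply: lt_trans (archi_boundP h) _; rewrite ltr_nat.
have [|B [iB cB]] := local_inter (t := t / n.+1%:R).
  by rewrite normf_div normr_nat ltr_pdivrMr // mulrC -ltr_pdivrMr.
have Bx : B x <> 0 by move=> Bx; move: cB; rewrite Bx rip0l leNgt c0.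
have [U [U' uU]] := inter_uint T_adj T_bnd T'_bnd T_irr (expi_conj _) iB Bx.
have [W [W' [uW _]]] := uint_iter n.+1 uU.
by exists W, W'; move: uW; rewrite expiX mulrC divfK ?pnatr_eq0.
Qed.

(** The local contraction is a U with |a| <= 1, so the lower bound holds for every unitary choice of
    [U]. *)
Let local_bound t U U' : `|t| < d -> uintT (expi t) U U' ->
  c ^+ 2 <= nsq (inner (U x) x).
Proof.
move=> td uU; have [B [iB cB]] := local_inter td.
have [a ha] := uint_unique T_adj T_bnd T'_bnd T_irr (expi_conj t) uU iB.
have a1 : nsq a <= 1.
  have [cBx _ _] := iB; have := cBx x; rewrite ha n2_scale (uint_n2 uU).
  by rewrite -ler_pdivlMr // divff // gt_eqF.
apply: (@le_trans _ _ (rip (B x) x ^+ 2)).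
  by rewrite ler_pXn2r // nnegrE ?ltW // (lt_le_trans c0).
apply: le_trans (Re_le_nsq _) _; rewrite ha innerZl nsqM.
by rewrite ler_piMl // nsq_ge0.
Qed.

(** As 2 pi / M < d, the first 2^n multiples of [s n] stay below [d]: a fraction 1 / M of the
    circle, whatever n is. *)
Let M := (Num.bound (2 * pi / d)).+1.
Let N n := (M * 2 ^ n)%N.
Let s n : R := 2 * pi / (N n)%:R.
(** The value of e for which 2 N (e n2 x) in [large_eigenvector] equals 2^n c^2; it does not depend
    on n. *)
Let k : R := c ^+ 2 / (2 * M%:R * n2 x).

Let N_gt0 n : (0 < N n)%N.
Proof. by rewrite muln_gt0 expn_gt0. Qed.

Let NR n : 0 < (N n)%:R :> R.
Proof. by rewrite ltr0n. Qed.

Let k_gt0 : 0 < k.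
Proof. by rewrite divr_gt0 ?exprn_gt0 // !mulr_gt0. Qed.

Let s_gt0 n : 0 < s n.
Proof. by rewrite divr_gt0 ?mulr_gt0 ?pi_gt0. Qed.

Let s_lt n l : (l < 2 ^ n)%N -> l%:R * s n < d.
Proof.
move=> ln; rewrite /s mulrA ltr_pdivrMr // /N natrM.
have h : 2 * pi < d * M%:R.
  rewrite [ltRHS]mulrC -ltr_pdivrMr //.
  have h0 : 0 <= 2 * pi / d by rewrite divr_ge0 ?mulr_ge0 ?pi_ge0 // ltW.
  by apply: lt_trans (archi_boundP h0) _; rewrite ltr_nat.
rewrite [d * _]mulrA [ltRHS]mulrC; apply: (@le_lt_trans _ _ ((2 ^ n)%:R * (2 * pi))).
  by rewrite ler_wpM2r ?mulr_ge0 ?pi_ge0 // ler_nat ltnW.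
by rewrite ltr_pM2l // ltr0n expn_gt0.
Qed.

Let s_split q n : (q <= n)%N -> s q = (2 ^ (n - q))%:R * s n.
Proof.
move=> qn; rewrite /s /N -{2}(subnKC qn) expnD !natrM.
have p2 m : (2 ^ m)%:R != 0 :> R by rewrite pnatr_eq0 -lt0n expn_gt0.
by field; rewrite !p2 pnatr_eq0.
Qed.

Let stage n : exists y U U' (a : R[i]), [/\ uintT (expi (s n)) U U',
  U y = a *: y, n2 y <= n2 x & k <= rip y x].
Proof.
have [U0 [U0' uU0]] := uint_all (s n).
have [W [W' [uW WE]]] := uint_iter (N n) uU0.
have sN : (N n)%:R * s n = pi *+ 2.
  by rewrite /s mulrC divfK ?gt_eqF // mulr_natl.
have e1 : expi (s n) ^+ N n = 1 by rewrite expiX sN /expi cos2pi sin2pi.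
rewrite e1 in uW.
have [_ _ _ iW] := uW.
have [b hb] := inter1_scalar T_adj T_bnd T'_bnd T_irr iW.
have b1 : nsq b = 1.
  have := uint_n2 uW x; rewrite hb n2_scale => /(canRL (mulfK _)) -> //.
    by rewrite divff // gt_eqF.
  by rewrite gt_eqF.
have [al bE] := nsq1_expi b1.
(* The N n-th power of [U0] is the scalar e^(i al); rotating by an N n-th root of its inverse makes
   that power 1. *)
have [U [U' [uU UE]]] := uintZ (- al / (N n)%:R) uU0.
have iterU l z : iter l U z = expi (- al / (N n)%:R) ^+ l *: iter l U0 z.
  elim: l => [|l IH]; first by rewrite scale1r.
  by rewrite !iterS IH UE (opZ U0) scalerA exprS.
have UN z : iter (N n) U z = z.
  rewrite iterU -WE hb scalerA expiX [_%:R * _]mulrC divfK ?gt_eqF //.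
  by rewrite bE -expiD addNr expi0 scale1r.
have [UU' U1 _ _] := uU.
have [|y [a [Uy yx ky]]] := @large_eigenvector _ _ _ _ _ UU' U1 (N_gt0 n) UN x k x_gt0 k_gt0.
  apply: (@le_trans _ _ ((2 ^ n)%:R * c ^+ 2)).
    rewrite le_eqVlt; apply/orP; left; apply/eqP; rewrite /k /N natrM.
    by field; rewrite pnatr_eq0 /= gt_eqF.
  apply: (@sum_ord_prefix R (fun l => nsq (inner (iter l U x) x))).
  - by rewrite leq_pmull.
  - by move=> l; exact: nsq_ge0.
  - move=> l ln; have [Wl [Wl' [uWl <-]]] := uint_iter l uU.
    rewrite expiX in uWl; apply: local_bound uWl.
    by rewrite ger0_norm ?s_lt // mulr_ge0 // ltW.
by exists y, U, U', a.
Qed.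

Lemma inter_fixed_vector : exists e : H, e <> 0 /\
  forall l, circle l -> exists A : {linear H -> H}, interT l A /\ A e = e.
Proof.
have [y hy] := choice stage.
have [F [FU Foo]] := @ultraFilterLemma nat \oo _.
have y_neq0 n : y n <> 0.
  have [U [U' [a [_ _ _]]]] := hy n => h y0; move: h; rewrite y0 rip0l.
  by rewrite leNgt k_gt0.
have [|e [_ ye]] := @ultra_weak_cvg R H nat F FU y (n2 x).
  by apply: nearW => n; have [U [U' [a []]]] := hy n.
have e0 : e <> 0.
  move=> e0; have : k <= rip e x.
    apply: (cvgr_to_ge (ye x)); apply: nearW => n.
    by have [U [U' [a []]]] := hy n.
  by rewrite e0 rip0l leNgt k_gt0.
have dyadic q p : exists A : {linear H -> H}, interT (expi (p%:R * s q)) A /\ A e = e.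
  have [W [W' uW]] := uint_all (p%:R * s q).
  (* The grids are nested: for n >= q, W is a multiple of the p 2^(n-q)-th power of the n-th
     unitary, so y n is an eigenvector of [W]. The value 0 for n < q is never met along [F]. *)
  have [chi hchi] : {chi : nat -> R[i] & forall n, (q <= n)%N ->
      W (y n) = chi n *: y n /\ nsq (chi n) = 1}.
    apply: (choice (P := fun n (a : R[i]) => (q <= n)%N ->
      W (y n) = a *: y n /\ nsq a = 1)) => n.
    have [U [U' [a [uU Uy _ _]]]] := hy n.
    have [qn|_] := leqP q n; last by exists 0.
    have [X [X' [uX XE]]] := uint_iter (p * 2 ^ (n - q)) uU.
    rewrite expiX natrM -mulrA -(s_split qn) in uX.
    have [_ _ _ iW] := uW.
    have [b hb] := uint_unique T_adj T_bnd T'_bnd T_irr (expi_conj _) uX iW.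
    have iy l : iter l U (y n) = a ^+ l *: y n.
      elim: l => [|l IH]; first by rewrite scale1r.
      by rewrite iterS IH (opZ U) Uy scalerA exprSr.
    have Wy : W (y n) = (b * a ^+ (p * 2 ^ (n - q))) *: y n.
      by rewrite hb XE iy scalerA.
    exists (b * a ^+ (p * 2 ^ (n - q))) => _; split => //.
    have := uint_n2 uW (y n); rewrite Wy n2_scale.
    have /gt_eqF/negbT yn := n2_gt0 (@y_neq0 n).
    by move=> /(canRL (mulfK yn)) ->; rewrite divff.
  have sq1 (u v : R) : u ^+ 2 + v ^+ 2 = 1 -> `|u| <= 1.
    by move=> h; rewrite -ler_sqr ?nnegrE // real_normK ?num_real // expr1n; nra.
  have [u hu] : exists u : R, complex.Re (chi n) @[n --> F] --> u.
    apply: (@ultra_bounded_cvg _ _ F _ _ 1); apply: Foo.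
    by exists q => // n /= /hchi [_]; exact: sq1.
  have [v hv] : exists v : R, complex.Im (chi n) @[n --> F] --> v.
    apply: (@ultra_bounded_cvg _ _ F _ _ 1); apply: Foo.
    by exists q => // n /= /hchi [_]; rewrite /nsq addrC; exact: sq1.
  have We : W e = (u +i* v) *: e.
    have [WW' _ _ _] := uW.
    apply: (@wlim_unique _ _ F _ _ _ (fun n => chi n *: y n) _ _ (wlim_adj WW' ye)).
      exact: wlimZ.
    by apply: Foo; exists q => // n /= /hchi [].
  (* The limit eigenvalue is unimodular because [W] is isometric; rotating [W] by its inverse then
     fixes e. *)
  have w1 : nsq (u +i* v) = 1.
    have := uint_n2 uW e; rewrite We n2_scale.
    have /gt_eqF/negbT en := n2_gt0 e0.
    by move=> /(canRL (mulfK en)) ->; rewrite divff.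
  have [al alE] := nsq1_expi w1.
  have [A [A' [[_ _ _ iA] AE]]] := uintZ (- al) uW.
  exists A; split => //.
  by rewrite AE We alE scalerA -expiD addrC subrr expi0 scale1r.
exists e; split => // l /circle_ex [t [t0 ->]].
(* The grid point just below t, within one step [s q]; a weak limit of the intertwiners for these
   points serves t. *)
pose th q := (Num.truncn (t / s q))%:R * s q.
have th_near q : `|t - th q| <= s q.
  have ts : 0 <= t / s q by rewrite divr_ge0 // ltW.
  have /andP[h1 h2] := truncn_itv ts.
  move: h1 h2; rewrite ler_pdivlMr // ltr_pdivrMr // -natr1 mulrDl mul1r -/(th q) => h1 h2.
  by rewrite ger0_norm ?subr_ge0 //; lra.
have th_cvg : th q @[q --> F] --> t.
  apply/cvgrPdist_lt => eps eps0.
  have e1 : 0 < eps / (2 * pi) by rewrite divr_gt0 ?mulr_gt0 ?pi_gt0.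
  have [q0 hq0] := natinv_small e1.
  apply: Foo; exists q0 => // q /= /hq0; rewrite ltr_pdivlMr ?mulr_gt0 ?pi_gt0 // => h.
  apply: le_lt_trans (th_near q) _; apply: le_lt_trans h.
  rewrite mulrC /s /natinv; apply: ler_wpM2l; first by rewrite mulr_ge0 ?pi_ge0.
  rewrite lef_pV2 ?posrE // ler_nat /N.
  by rewrite (leq_trans (ltn_expl q (ltnSn 1))) // leq_pmull.
have [A hA] := choice (fun q => dyadic q (Num.truncn (t / s q))).
have [|B [cB hB]] := @ultra_wlim_op R H H nat F FU (fun q => A q).
  apply: nearW => q; have [[cA _ _] _] := hA q; split => //.
  by move=> a u v; rewrite (opD (A q)) (opZ (A q)).
exists B; split.
  apply: (inter_wlim (A := fun q => A q) (l := fun q => expi (th q)) _ T_adj _ _ _ cB hB).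
  - by move=> U /continuous_cos /th_cvg.
  - by move=> U /continuous_sin /th_cvg.
  - by apply: nearW => q; have [] := hA q.
apply: (@wlim_unique _ _ F _ _ _ (fun=> e) _ _ (hB e)).
  exact: wlim_cst.
by apply: nearW => q; have [] := hA q.
Qed.

End CommonEigenvector.

(** * The representations and their direct sum *)

Section IrreducibleRepresentation.
Variables (R : realType) (H : hilbertType R) (T T' : {linear H -> H}).
Variables (KT KT' : R).
Hypotheses (T_adj : adjp T T') (T_bnd : bnd T KT) (T'_bnd : bnd T' KT').
Hypothesis T_irr : irr T T'.

Local Notation interT := (inter T T' T T').

(** Both maps are multiples of one unitary, and the nonzero vector e determines the multiple. *)
Lemma inter_fixing_unique l (A B : {linear H -> H}) e : circle l -> e <> 0 ->
  interT l A -> interT l B -> A e = e -> B e = e -> forall x, A x = B x.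
Proof.
move=> /circleP l1 e0 iA iB Ae Be x.
have Ae0 : A e <> 0 by rewrite Ae.
have [U [U' uU]] := inter_uint T_adj T_bnd T'_bnd T_irr l1 iA Ae0.
have [a ha] := uint_unique T_adj T_bnd T'_bnd T_irr l1 uU iA.
have [b hb] := uint_unique T_adj T_bnd T'_bnd T_irr l1 uU iB.
have : (a - b) *: U e = 0 by rewrite scalerBl -ha -hb Ae Be subrr.
move=> /eqP; rewrite scaler_eq0 => /orP[|/eqP Ue].
  by rewrite subr_eq0 => /eqP ab; rewrite ha hb ab.
by case: Ae0; rewrite ha Ue scaler0.
Qed.

(** Continuity is tested weakly along ultrafilters, the form that compactness delivers; isometry
    upgrades it in [assemble_rep]. *)
Definition continuous_rep (W : R[i] -> {linear H -> H}) :=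
  [/\ forall l, circle l -> interT l (W l),
      forall l m, circle l -> circle m -> forall x, W (l * m) x = W l (W m x),
      forall x, W 1 x = x &
      forall (F : set_system R[i]) (l0 : R[i]), UltraFilter F -> F (@circle R) -> circle l0 ->
        complex.Re l @[l --> F] --> complex.Re l0 ->
        complex.Im l @[l --> F] --> complex.Im l0 ->
        forall x, wlim F (fun l => W l x) (W l0 x)].

Lemma circle1 : circle (1 : R[i]).
Proof. by rewrite /circle /= normr1. Qed.

Lemma circleM (l m : R[i]) : circle l -> circle m -> circle (l * m).
Proof. by rewrite /circle /= => l1 m1; rewrite normrM l1 m1 mulr1. Qed.

(** Products and weak limits of intertwiners fixing e are intertwiners fixing e, so uniqueness
    yields both multiplicativity and continuity. *)
Lemma fixed_vector_rep (e : H) : e <> 0 ->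
  (forall l, circle l -> exists A : {linear H -> H}, interT l A /\ A e = e) ->
  exists W, continuous_rep W.
Proof.
move=> e0 he.
have [W hW] : {W : R[i] -> {linear H -> H} & forall l, circle l ->
    interT l (W l) /\ W l e = e}.
  apply: (choice (P := fun l (A : {linear H -> H}) => circle l ->
    interT l A /\ A e = e)) => l.
  by have [/he [A hA]|nl] := pselect (circle l); [exists A | exists idfun].
exists W; split.
- by move=> l /hW [].
- move=> l m cl cm; have [iW We] := hW _ (circleM cl cm).
  have [il le] := hW _ cl; have [im me] := hW _ cm.
  apply: (inter_fixing_unique (B := (W l \o W m)%FUN) (circleM cl cm) e0 iW _ We).
    by rewrite mulrC; exact: inter_comp im il.
  by rewrite /= me le.
- have [i1 e1] := hW _ circle1.
  apply: (inter_fixing_unique (B := idfun) circle1 e0 i1 _ e1) => //.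
  by have [] := uint1 T T'.
- move=> F l0 FU Fc cl0 hr hi.
  have [|B [cB hB]] := @ultra_wlim_op R H H R[i] F FU (fun l => W l).
    apply: filterS Fc => l /hW [[cW _ _] _]; split => //.
    by move=> a u v; rewrite (opD (W l)) (opZ (W l)).
  have iB : interT l0 B.
    apply: (inter_wlim (A := fun l => W l) (l := id) _ T_adj hr hi _ cB hB).
    by apply: filterS Fc => l /hW [].
  have Be : B e = e.
    apply: (@wlim_unique _ _ F _ _ _ (fun=> e) _ _ (hB e)); first exact: wlim_cst.
    by apply: filterS Fc => l /hW [].
  have [il0 el0] := hW _ cl0.
  by move=> x; rewrite -(inter_fixing_unique cl0 e0 iB il0 Be el0).
Qed.

End IrreducibleRepresentation.

Lemma normc_ge_Im (R : rcfType) (a : R[i]) : `|complex.Im a|%:C <= `|a|.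
Proof. by rewrite normc_def lecR -sqrtr_sqr ler_wsqrtr // lerDr sqr_ge0. Qed.

(** Reduces convergence along a filter to convergence along finer ultrafilters. *)
Lemma ultra_compl (I : Type) (F : set_system I) (A : set I) : Filter F -> ~ F A ->
  exists G, [/\ UltraFilter G, F `<=` G & G (~` A)].
Proof.
move=> FF nFA.
have : ProperFilter (within (~` A) F).
  split; last exact: within_filter.
  by rewrite /within /= => h; apply: nFA; apply: filterS h => x /= /contrapT.
move=> /ultraFilterLemma [G [GU wG]]; exists G; split => //.
  by move=> B FB; apply: wG; rewrite /within /=; apply: filterS FB => x + _.
by apply: wG; rewrite /within /=; exact: nearW.
Qed.

Lemma inverse_contr_unitary (R : realType) (H : hilbertType R) (U U' : {linear H -> H}) :
  contr U -> contr U' -> (forall x, U' (U x) = x) -> (forall x, U (U' x) = x) ->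
  unitary U.
Proof.
move=> cU cU' U1 U2.
have nU x : n2 (U x) = n2 x.
  by apply/le_anti; rewrite cU /= -{1}[x]U1 cU'.
have rU x y : rip (U x) (U y) = rip x y.
  by have := nU (x + y); rewrite opD !n2D !nU; lra.
have UU' : adjp U U' by move=> x y; rewrite -{1}[y]U2 rU.
by split; [exact: contr_bounded | |] => x; rewrite (adjp_adjoint UU').
Qed.

Section Assembly.
Variables (R : realType) (H : hilbertType R) (J : countType).
Variables (Hs : J -> hilbertType R) (V : forall j, {linear Hs j -> H}).
Hypothesis V_dec : orthogonal_decomposition V.

(** Boundedness provides adjoints, which move the question to [V_dense_eq]. *)
Lemma V_ext_eq (A B : {linear H -> H}) KA KB : bnd A KA -> bnd B KB ->
  (forall j u, A (V j u) = B (V j u)) -> forall z, A z = B z.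
Proof.
move=> /adjp_ex [A' AA'] /adjp_ex [B' BB'] AB z; apply: rip_eq => w.
rewrite AA' BB'; congr rip; apply: (V_dense_eq V_dec) => j u.
by rewrite -AA' -BB' AB.
Qed.

Lemma contr_bnd (A : {linear H -> H}) : contr A -> bnd A 1.
Proof. by move=> cA x; rewrite mul1r. Qed.

Lemma n2_sum (s : seq J) (x : forall j, Hs j) : uniq s ->
  n2 (\sum_(j <- s) V j (x j)) = \sum_(j <- s) n2 (x j).
Proof.
elim: s => [|j s IH] /=; first by rewrite !big_nil n2_0.
move=> /andP[js us]; rewrite !big_cons n2D (V_n2 V_dec) IH //.
suff -> : rip (V j (x j)) (\sum_(k <- s) V k (x k)) = 0 by rewrite mulr0 addr0.
elim: s js {us IH} => [|k s IH]; first by rewrite big_nil rip0r.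
rewrite inE negb_or => /andP[jk js]; rewrite big_cons ripDr IH // addr0.
by apply: (V_orth V_dec); apply/eqP.
Qed.

(** The partial sums over indices of code below n are contractions by Bessel's inequality; a weak
    limit along an ultrafilter replaces summing the series. *)
Lemma contr_extension (W : forall j, {linear Hs j -> Hs j}) :
  (forall j, contr (W j)) ->
  exists U : {linear H -> H}, contr U /\ forall j x, U (V j x) = V j (W j x).
Proof.
move=> cW; have [V' VV'] := V_adj V_dec.
pose s n := pmap (@pickle_inv J) (iota 0 n).
have s_uniq n : uniq (s n) by apply: (pmap_uniq (@pickle_invK J)); exact: iota_uniq.
have s_mem k n : (pickle k < n)%N -> k \in s n.
  by move=> kn; rewrite mem_pmap; apply/mapP; exists (pickle k); rewrite ?mem_iota ?pickleK_inv.
pose A n z := \sum_(j <- s n) V j (W j (V' j z)).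
have A_contr n : contr (A n).
  move=> z; rewrite /A (n2_sum (fun j => W j (V' j z))) //.
  apply: (@le_trans _ _ (\sum_(j <- s n) n2 (V' j z))).
    by apply: ler_sum => j _; exact: cW.
  pose p := \sum_(j <- s n) V j (V' j z).
  have pz : rip p z = \sum_(j <- s n) n2 (V' j z).
    rewrite /rip /p inner_suml raddf_sum; apply: eq_bigr => j _.
    exact: (VV' j).
  have := rip_le p z; rewrite pz {1}/p (n2_sum (fun j => V' j z)) //; lra.
have A_lin n : linear (A n).
  move=> a u v; rewrite /A scaler_sumr -big_split; apply: eq_bigr => j _ /=.
  by rewrite (opD (V' j)) (opZ (V' j)) (opD (W j)) (opZ (W j)) (opD (V j)) (opZ (V j)).
have [F [FU Foo]] := @ultraFilterLemma nat \oo _.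
have [|U [cU hU]] := @ultra_wlim_op R H H nat F FU A; first exact: nearW.
exists U; split => // k x.
apply: (@wlim_unique _ _ F _ _ _ (fun=> V k (W k x)) _ _ (hU _)); first exact: wlim_cst.
apply: Foo; exists (pickle k).+1 => // n /= /s_mem kn.
rewrite /A (bigD1_seq k) //= big1 ?addr0.
  congr (V k (W k _)); apply: rip_eqr => w; rewrite -(VV' k); exact: (V_rip V_dec).
move=> j jk; suff -> : V' j (V k x) = 0 by rewrite !op0.
by apply: rip_eqr => w; rewrite -(VV' j) rip0r (V_orth V_dec) //; exact/eqP.
Qed.

Variables (T : {linear H -> H}) (Ts Ts' : forall j, {linear Hs j -> Hs j}).
Variable KT : R.
Hypothesis T_bnd : bnd T KT.
Hypothesis TV : forall j x, T (V j x) = V j (Ts j x).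

Lemma assemble_rep :
  (forall j, exists W, continuous_rep (Ts j) (Ts' j) W) -> strongly_circular T.
Proof.
move=> hW.
pose W j := projT1 (cid (hW j)).
have repW j : continuous_rep (Ts j) (Ts' j) (W j) := projT2 (cid (hW j)).
have [U hU] : {U : R[i] -> {linear H -> H} & forall l, circle l ->
    contr (U l) /\ forall j x, U l (V j x) = V j (W j l x)}.
  apply: (choice (P := fun l (A : {linear H -> H}) => circle l ->
    contr A /\ forall j x, A (V j x) = V j (W j l x))) => l.
  have [cl|nl] := pselect (circle l); last by exists idfun.
  have [|A hA] := @contr_extension (fun j => W j l); last by exists A.
  by move=> j; have [/(_ l cl) [] ] := repW j.
have UM l m : circle l -> circle m -> forall x, U (l * m) x = U l (U m x).
  move=> cl cm; have [cU UV] := hU _ (circleM cl cm).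
  have [cUl UVl] := hU _ cl; have [cUm UVm] := hU _ cm.
  apply: (V_ext_eq (B := (U l \o U m)%FUN) (contr_bnd cU)).
    by apply: (contr_bnd (A := (U l \o U m)%FUN)) => x; exact: le_trans (cUl _) (cUm _).
  by move=> j u; rewrite UV /= UVm UVl; have [_ -> //] := repW j.
have U1 x : U 1 x = x.
  have [cU UV] := hU _ (@circle1 R).
  apply: (V_ext_eq (B := idfun) (contr_bnd cU) (KB := 1)).
    by move=> z; rewrite mul1r.
  by move=> j u; rewrite UV /=; have [_ _ -> _] := repW j.
have circleJ l : circle l -> circle (conjc l : R[i]).
  by move=> /circleP l1; apply/circleP; rewrite conjcK mulrC.
have U_unitary l : circle l -> unitary (U l).
  move=> cl; have cl' := circleJ _ cl; have /circleP l1 := cl.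
  apply: (inverse_contr_unitary (hU _ cl).1 (hU _ cl').1) => x.
    by rewrite -UM // mulrC l1 U1.
  by rewrite -UM // l1 U1.
exists U; split; last first.
  move=> l cl; have [cU UV] := hU _ cl.
  have [B hB] : exists B : {linear H -> H}, forall x, B x = l *: T (U l x).
    apply: linear_pack => a x y.
    by rewrite (opD (U l)) (opZ (U l)) (opD T) (opZ T) scalerDr !scalerA mulrC.
  move=> x; rewrite -hB.
  apply: (V_ext_eq (A := (U l \o T)%FUN) (KA := KT) (KB := KT)).
  - by move=> z; exact: le_trans (cU _) (T_bnd _).
  - move=> z; rewrite hB n2_scale; have /circleP := cl.
    rewrite -nsqE => /(@complexI R _ 1) ->; rewrite mul1r.
    by rewrite -(unitary_n2 (U_unitary _ cl) z).
  - move=> j u; rewrite hB /= TV !UV TV; have [/(_ l cl) [_ -> _] _ _ _] := repW j.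
    by rewrite (opZ (V j)).
split => // x.
(* If strong continuity failed at l0, some ultrafilter tending to l0 would avoid a neighbourhood of
   U l0 x, although U l x tends weakly to U l0 x along it. *)
apply/subspace_continuousP => l0 cl0.
apply/cvg_n2P => eps eps0; apply: contrapT => nF.
have [G [GU FG Gn]] := ultra_compl _ nF.
have Gc : G (@circle R) by apply: FG; rewrite /within /=; exact: nearW.
have Gnear (e : R) : 0 < e -> G [set l : R[i] | `|l0 - l| < e%:C].
  move=> e0; apply: FG; rewrite /within /=.
  have : nbhs (l0 : R[i]^o) [set l : R[i]^o | `|l0 - l| < e%:C].
    by apply/nbhs_ballP; exists e%:C; rewrite /= ?ltcR // => l; rewrite -ball_normE.
  by apply: filterS => l /= + _.
have hr : complex.Re l @[l --> G] --> complex.Re l0.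
  apply/cvgrPdist_lt => e e0; apply: filterS (Gnear e e0) => l /= h.
  rewrite -ltcR; apply: le_lt_trans h.
  by rewrite -ReN -ReD; exact: normc_ge_Re.
have hi : complex.Im l @[l --> G] --> complex.Im l0.
  apply/cvgrPdist_lt => e e0; apply: filterS (Gnear e e0) => l /= h.
  rewrite -ltcR; apply: le_lt_trans h.
  rewrite (_ : complex.Im l0 - complex.Im l = complex.Im (l0 - l)); last by case: (l0) => ? ?; case: (l).
  exact: normc_ge_Im.
have [|B [cB hB]] := @ultra_wlim_op R H H R[i] G GU (fun l => U l).
  apply: filterS Gc => l /hU [cU _]; split => //.
  by move=> a u v; rewrite (opD (U l)) (opZ (U l)).
have [cU0 UV0] := hU _ cl0.
have BU : forall z, B z = U l0 z.
  apply: (V_ext_eq (contr_bnd cB) (contr_bnd cU0)) => j u.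
  have [V' VV'] := V_adj V_dec.
  have [_ _ _ /(_ G l0 GU Gc cl0 hr hi u) hw] := repW j.
  apply: (@wlim_unique _ _ G _ _ _ (fun l => V j (W j l u)) _ _ (hB _)).
    by rewrite UV0; exact: (wlim_adj (VV' j) hw).
  by apply: filterS Gc => l /hU [_ ->].
have := hB x (U l0 x); rewrite BU -/(n2 _) (unitary_n2 (U_unitary _ cl0)).
move=> /cvgrPdist_lt /(_ (eps / 2)).
have e2 : 0 < eps / 2 by lra.
move=> /(_ e2) h.
have [l [cl [/= ln lh]]] := filter_ex (filterI Gc (filterI Gn h)).
(* The norms being equal, the squared distance is 2 n2 x - 2 rip (U l x) (U l0 x), which weak
   convergence makes small. *)
apply: ln; rewrite n2B (unitary_n2 (U_unitary _ cl)) (unitary_n2 (U_unitary _ cl0)).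
move: lh; rewrite ltr_norml => /andP[_]; lra.
Qed.

End Assembly.

Lemma circular_strongly_circular (R : realType) (H : hilbertType R) (J : countType)
    (Hs : J -> hilbertType R) (V : forall j, {linear Hs j -> H})
    (T : {linear H -> H}) (Ts : forall j, {linear Hs j -> Hs j}) :
  separable H -> bounded_operator T -> (forall j, bounded_operator (Ts j)) ->
  (forall j, irreducible (Ts j)) -> direct_sum_operator V T Ts ->
  circular T -> strongly_circular T.
Proof.
move=> H_sep T_bd Ts_bd Ts_irr [V_dec TV] T_circ.
have [KT KT0 T_bnd] := bounded_bnd T_bd.
have [T' T_adj] := adjp_ex T_bnd.
have adj_ex j : exists B : {linear Hs j -> Hs j}, adjp (Ts j) B.
  by have [K _ /adjp_ex] := bounded_bnd (Ts_bd j).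
pose Ts' j := projT1 (cid (adj_ex j)).
have Ts_adj j : adjp (Ts j) (Ts' j) := projT2 (cid (adj_ex j)).
apply: (assemble_rep V_dec T_bnd TV (Ts' := Ts')) => j.
(* A summand may be zero; the constant identity then serves as its representation. *)
have [[x x0]|hn] := pselect (exists x : Hs j, x <> 0); last first.
  have eq0 (u v : Hs j) : u = v.
    suff z (w : Hs j) : w = 0 by rewrite (z u) (z v).
    by apply: contrapT => w0; apply: hn; exists w.
  exists (fun=> idfun); split => //; first by move=> l _; split => // x; exact: eq0.
  by move=> F l0 FU _ _ _ _ x; exact: wlim_cst.
have [K K0 bK] := bounded_bnd (Ts_bd j).
have bK' := adjp_bnd K0 (Ts_adj j) bK.
have irr_j : irr (Ts j) (Ts' j).
  move=> M cM MT MT'; apply: Ts_irr; split => // u /MT'.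
  by rewrite (adjp_adjoint (Ts_adj j)).
have [c [d [c0 d0 loc]]] := summand_local_inter V_dec T_adj Ts_adj TV T_circ H_sep x0.
have [e [e0 he]] := inter_fixed_vector (Ts_adj j) bK bK' irr_j c0 d0 loc.
exact: (fixed_vector_rep (Ts_adj j) bK bK' irr_j e0 he).
Qed.

Theorem theorem1p1 (R : realType) (H : hilbertType R)
    (n : option nat) (Hs : summands n -> hilbertType R)
    (V : forall j : summands n, {linear Hs j -> H})
    (T : {linear H -> H})
    (Ts : forall j : summands n, {linear Hs j -> Hs j}) :
  separable H ->
  n <> Some 0%N ->
  bounded_operator T ->
  (forall j : summands n, bounded_operator (Ts j)) ->
  (forall j : summands n, irreducible (Ts j)) ->
  direct_sum_operator V T Ts ->
  circular T <-> strongly_circular T.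
Proof.
move=> H_sep _ T_bd Ts_bd Ts_irr T_sum; split; last first.
  by move=> [U [[U_un _ _] UT]] l cl; exists (U l); split; [exact: U_un | exact: UT].
case: n Hs V Ts Ts_bd Ts_irr T_sum => [m|] Hs V Ts Ts_bd Ts_irr T_sum.
  exact: (@circular_strongly_circular R H 'I_m Hs V T Ts).
exact: (@circular_strongly_circular R H nat Hs V T Ts).
Qed.
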